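(* Let $(A,\mathbb{N}^2,\alpha)$ be a dynamical system consisting of a $C^*$-algebra $A$ and an action $\alpha$ of $\mathbb{N}^2$ on $A$ by automorphisms. Let $\pi:A\to B(H)$ be a nonzero irreducible representation of $A$ with $P=\ker\pi$. Let $(\tilde\pi,V)$ be the covariant partial-isometric representation of $(A,\mathbb{N}^2,\alpha)$ on $\ell^2(\mathbb{N}^2)\otimes H\simeq \ell^2(\mathbb{N}^2,H)$ given by $$(\tilde\pi(a)f)(s)=\pi(\alpha_s(a))f(s),\qquad (V_tf)(s)=f(s+t)$$ for $a\in A$, $f\in\ell^2(\mathbb{N}^2,H)$, $s,t\in\mathbb{N}^2$. Then the corresponding representation $\tilde\pi\times V$ of $(A\times_\alpha^{\mathrm{piso}}\mathbb{N}^2,i_A,i_{\mathbb{N}^2})$ is irreducible on $\ell^2(\mathbb{N}^2)\otimes H$, and it lives on the ideal $L\simeq\mathcal{K}(\ell^2(\mathbb{N}^2))\otimes A$ of $A\times_\alpha^{\mathrm{piso}}\mathbb{N}^2$ (that is, its restriction to $L$ is nonzero).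
   Context: $\mathbb{N}=\{0,1,2,\dots\}$; $\mathbb{N}^2$ is the positive cone of the lattice-ordered group $\mathbb{Z}^2$ (coordinatewise order, $\vee$ denotes the join); $\alpha_0=\mathrm{id}$ and $\alpha_{s+t}=\alpha_s\alpha_t$; $A$ need not be unital. A covariant partial-isometric representation of $(A,\mathbb{N}^2,\alpha)$ on a Hilbert space $K$ is a pair $(\rho,W)$ where $\rho$ is a nondegenerate representation of $A$ on $K$ and $W:\mathbb{N}^2\to B(K)$ is a map into partial isometries with $W_0=1$, $W_sW_t=W_{s+t}$, $W_s^*W_sW_t^*W_t=W_{s\vee t}^*W_{s\vee t}$, such that $\rho(\alpha_s(a))=W_s\rho(a)W_s^*$ and $W_s^*W_s\rho(a)=\rho(a)W_s^*W_s$ for all $a\in A$, $s,t\in\mathbb{N}^2$. The partial-isometric crossed product $(A\times_\alpha^{\mathrm{piso}}\mathbb{N}^2,i_A,i_{\mathbb{N}^2})$ is the $C^*$-algebra universal for such pairs: $i_A:A\to A\times_\alpha^{\mathrm{piso}}\mathbb{N}^2$ is a nondegenerate homomorphism, $i_{\mathbb{N}^2}:\mathbb{N}^2\to M(A\times_\alpha^{\mathrm{piso}}\mathbb{N}^2)$ is a map into partial isometries, with $i_{\mathbb{N}^2}(0)=1$, $i_{\mathbb{N}^2}(s)i_{\mathbb{N}^2}(t)=i_{\mathbb{N}^2}(s+t)$, $i_{\mathbb{N}^2}(s)^*i_{\mathbb{N}^2}(s)i_{\mathbb{N}^2}(t)^*i_{\mathbb{N}^2}(t)=i_{\mathbb{N}^2}(s\vee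 t)^*i_{\mathbb{N}^2}(s\vee t)$, $i_A(\alpha_s(a))=i_{\mathbb{N}^2}(s)i_A(a)i_{\mathbb{N}^2}(s)^*$ and $i_{\mathbb{N}^2}(s)^*i_{\mathbb{N}^2}(s)i_A(a)=i_A(a)i_{\mathbb{N}^2}(s)^*i_{\mathbb{N}^2}(s)$ for all $a\in A$, $s,t\in\mathbb{N}^2$, $A\times_\alpha^{\mathrm{piso}}\mathbb{N}^2=\overline{\mathrm{span}}\{i_{\mathbb{N}^2}(s)^*i_A(a)i_{\mathbb{N}^2}(t):s,t\in\mathbb{N}^2,a\in A\}$, and each covariant partial-isometric representation $(\rho,W)$ yields a unique nondegenerate representation $\rho\times W$ with $(\rho\times W)\circ i_A=\rho$ and $\overline{\rho\times W}\circ i_{\mathbb{N}^2}=W$ (bar: extension to the multiplier algebra). Put $\xi_{(m,n)}^{(x,y)}(a)=i_{\mathbb{N}^2}(m,n)^*i_A(a)[1-i_{\mathbb{N}^2}(1,0)^*i_{\mathbb{N}^2}(1,0)]i_{\mathbb{N}^2}(x,y)$. It is known that the closed linear span $L$ of the elements $\xi_{(m,n)}^{(x,y)}(a)-\xi_{(m,n+1)}^{(x,y+1)}(\alpha_{(0,1)}(a))$ ($a\in A$, $(m,n),(x,y)\in\mathbb{N}^2$) is an essential ideal of $A\times_\alpha^{\mathrm{piso}}\mathbb{N}^2$, isomorphic to $\mathcal{K}(\ell^2(\mathbb{N}^2))\otimes A$ by the isomorphism sending (rank-one operator $g\mapsto\langle g|e_{(x,y)}\rangle e_{(m,n)}$)$\otimes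 a$ to $\xi_{(m,n)}^{(x,y)}(a)-\xi_{(m,n+1)}^{(x,y+1)}(\alpha_{(0,1)}(a))$, where $\{e_{(m,n)}\}$ is the usual orthonormal basis of $\ell^2(\mathbb{N}^2)$. *)

(* Defs.v *)
From HB Require Import structures.
From mathcomp Require Import all_boot all_order all_algebra.
From mathcomp Require Import complex ring lra zify.
From mathcomp Require Import all_classical all_reals.
From mathcomp Require Import ereal topology normedtype sequences esum.
Set Implicit Arguments. Unset Strict Implicit. Unset Printing Implicit Defensive.
Import Order.TTheory GRing.Theory Num.Theory.
Import numFieldNormedType.Exports.
Local Open Scope classical_set_scope.
Local Open Scope ring_scope.

Notation N2 := (nat * nat)%type.

Section InnerProduct.
Variables (K : numClosedFieldType) (V : lmodType K) (d : V -> V -> K).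
Hypothesis dDl : forall x y z, d (x + y) z = d x z + d y z.
Hypothesis dZl : forall c x y, d (c *: x) y = c * d x y.
Hypothesis dC : forall x y, d y x = (d x y)^*.
Hypothesis d_ge0 : forall x, 0 <= d x x.
Hypothesis d_eq0 : forall x, d x x = 0 -> x = 0.

Lemma ip_DrE x y z : d x (y + z) = d x y + d x z.
Proof. by rewrite dC dDl rmorphD /= -!dC. Qed.

Lemma ip_ZrE c x y : d x (c *: y) = c^* * d x y.
Proof. by rewrite dC dZl rmorphM /= -dC. Qed.

Lemma ip_0l x : d 0 x = 0.
Proof. by rewrite -(scale0r 0) dZl mul0r. Qed.

Lemma ip_CauchySchwarz x y : `|d x y| ^+ 2 <= d x x * d y y.
Proof.
have [y0|y0] := eqVneq (d y y) 0.
  by rewrite (d_eq0 y0) dC !ip_0l rmorph0 normr0 expr0n mulr0.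
have yp : 0 < d y y by rewrite lt_def y0 d_ge0.
have := d_ge0 (x - (d x y / d y y) *: y).
have yR : (d y y)^* = d y y by rewrite -dC.
rewrite -scaleNr !(dDl, ip_DrE, dZl, ip_ZrE) (dC x y).
have -> : (- (d x y / d y y))^* = - ((d x y)^* / d y y).
  by rewrite rmorphN rmorphM fmorphV /= yR.
set a := d x y; set b := d y y; set c := d x x.
have -> : c + - (a^* / b) * a + (- (a / b) * a^* + - (a / b) * (- (a^* / b) * b))
  = c - a * a^* / b by field; rewrite y0.
rewrite subr_ge0 ler_pdivrMr // -normCK; exact.
Qed.

Lemma ip_norm x y : `|d x y| <= sqrtC (d x x) * sqrtC (d y y).
Proof.
rewrite -(@ler_pXn2r _ 2) ?nnegrE ?mulr_ge0 ?sqrtC_ge0 //.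
by rewrite exprMn !sqrtCK ip_CauchySchwarz.
Qed.

Lemma ip_triangle x y :
  sqrtC (d (x + y) (x + y)) <= sqrtC (d x x) + sqrtC (d y y).
Proof.
rewrite -(@ler_pXn2r _ 2) ?nnegrE ?addr_ge0 ?sqrtC_ge0 //.
rewrite sqrrD !sqrtCK dDl !ip_DrE (dC x y).
have r : d x y + (d x y)^* \is Num.real by rewrite CrealE rmorphD /= conjCK addrC.
have h : d x y + (d x y)^* <= sqrtC (d x x) * sqrtC (d y y) *+ 2.
  apply: (le_trans (real_ler_norm r)); apply: (le_trans (ler_normD _ _)).
  by rewrite norm_conjC -mulr2n lerMn2r ip_norm.
have -> : d x x + d x y + ((d x y)^* + d y y) =
  d x x + d y y + (d x y + (d x y)^*) by ring.
have -> : d x x + sqrtC (d x x) * sqrtC (d y y) *+ 2 + d y y =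
  d x x + d y y + sqrtC (d x x) * sqrtC (d y y) *+ 2 by ring.
by rewrite lerD2l.
Qed.

Lemma ip_scale c x : sqrtC (d (c *: x) (c *: x)) = `|c| * sqrtC (d x x).
Proof.
rewrite dZl ip_ZrE mulrA -normCK rootCMl ?exprn_ge0 //.
by rewrite sqrCK.
Qed.

End InnerProduct.

(* Hilbert spaces; the inner product is linear in its first argument *)
HB.mixin Record isHilbert (R : realType) V of CompleteNormedModule R[i] V := {
  dot : V -> V -> R[i];
  dotDl : forall x y z, dot (x + y) z = dot x z + dot y z;
  dotZl : forall (c : R[i]) x y, dot (c *: x) y = c * dot x y;
  dotC : forall x y, dot y x = (dot x y)^*;
  dot_norm : forall x, dot x x = `|x| ^+ 2
}.

#[short(type="hilbertType")]
HB.structure Definition Hilbert (R : realType) :=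
  {V of CompleteNormedModule R[i] V & isHilbert R V}.

Section HilbertTheory.
Variables (R : realType) (H : hilbertType R).
Implicit Types x y z : H.

Lemma dotDr x y z : dot x (y + z) = dot x y + dot x z.
Proof. exact: (ip_DrE dotDl dotC). Qed.

Lemma dotZr c x y : dot x (c *: y) = c^* * dot x y.
Proof. exact: (ip_ZrE dotZl dotC). Qed.

Lemma dot_ge0 x : 0 <= dot x x.
Proof. by rewrite dot_norm exprn_ge0. Qed.

Lemma dot_eq0 x : dot x x = 0 -> x = 0.
Proof. by rewrite dot_norm => /eqP; rewrite expf_eq0 /= normr_eq0 => /eqP. Qed.

Lemma dot_norm_le x y : `|dot x y| <= `|x| * `|y|.
Proof.
have := ip_norm dotDl dotZl dotC dot_ge0 dot_eq0 x y.
by rewrite !dot_norm !sqrCK.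
Qed.

(* norms of normed modules over R[i] take values in R[i] *)
Definition rnorm x : R := complex.Re `|x|.

Lemma rnormE x : (rnorm x)%:C%C = `|x|.
Proof. by rewrite RRe_real // normr_real. Qed.

Lemma rnorm_ge0 x : 0 <= rnorm x.
Proof. by rewrite -ler0c rnormE. Qed.

Lemma rnormD x y : rnorm (x + y) <= rnorm x + rnorm y.
Proof. by rewrite -lecR rmorphD /= !rnormE ler_normD. Qed.

Lemma rnormZ c x : rnorm (c *: x) = Normc.normc c * rnorm x.
Proof. by apply: complexI; rewrite rmorphM /= !rnormE normrZ. Qed.

Lemma rnormN x : rnorm (- x) = rnorm x.
Proof. by rewrite /rnorm normrN. Qed.

Lemma dot_rnorm x : dot x x = (rnorm x ^+ 2)%:C%C.
Proof. by rewrite rmorphXn /= rnormE dot_norm. Qed.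

Lemma rnormD_sqr x y : rnorm (x + y) ^+ 2 <= 2 * rnorm x ^+ 2 + 2 * rnorm y ^+ 2.
Proof.
have h := rnormD x y; have h0 := rnorm_ge0 (x + y).
have : rnorm (x + y) ^+ 2 <= (rnorm x + rnorm y) ^+ 2.
  by rewrite ler_pXn2r // nnegrE addr_ge0 // rnorm_ge0.
have := sqr_ge0 (rnorm x - rnorm y); nra.
Qed.

Lemma dot_le_sqr x y : Normc.normc (dot x y) <= rnorm x ^+ 2 + rnorm y ^+ 2.
Proof.
have : Normc.normc (dot x y) <= rnorm x * rnorm y.
  by rewrite -lecR rmorphM /= !rnormE; exact: dot_norm_le.
have := sqr_ge0 (rnorm x - rnorm y); have := sqr_ge0 (rnorm x + rnorm y); nra.
Qed.

End HilbertTheory.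

Section SquareSums.
Variable R : realType.
Implicit Types (a b : N2 -> R) (n m : nat).

Definition box n : seq (nat * nat) :=
  [seq (i, j) | i <- index_iota 0 n, j <- index_iota 0 n].

Lemma mem_box n s : (s \in box n) = (s.1 < n)%N && (s.2 < n)%N.
Proof.
apply/allpairsP/idP => [[p [+ + ->]]|/andP[h1 h2]] /=.
  by rewrite !mem_index_iota /= => -> ->.
by exists s; rewrite !mem_index_iota h1 h2 -surjective_pairing.
Qed.

Lemma box_uniq n : uniq (box n).
Proof.
by apply: allpairs_uniq; rewrite ?iota_uniq // => -[? ?] [? ?] _ _ [-> ->].
Qed.

Lemma le_uniq_sum (r r' : seq (nat * nat)) a : (forall s, 0 <= a s) ->
  uniq r -> uniq r' -> {subset r <= r'} -> \sum_(s <- r) a s <= \sum_(s <- r') a s.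
Proof.
move=> a0 ur ur' sub; rewrite [leRHS](bigID (mem r)) /=.
have hp : perm_eq [seq s <- r' | s \in r] r.
  apply: uniq_perm; rewrite ?filter_uniq // => s.
  by rewrite mem_filter; case: (boolP (s \in r)) => //= /sub.
by rewrite -[X in X + _]big_filter (perm_big _ hp) lerDl sumr_ge0.
Qed.

Definition bsum a n := \sum_(s <- box n) a s.

Lemma bsum_nd a : (forall s, 0 <= a s) -> {homo bsum a : n m / (n <= m)%N >-> n <= m}.
Proof.
move=> a0 n m nm; apply: le_uniq_sum; rewrite ?box_uniq // => s.
by rewrite !mem_box => /andP[h1 h2]; rewrite (leq_trans h1 nm) (leq_trans h2 nm).
Qed.

Lemma esum_bsum a : (forall s, 0 <= a s) ->
  ((\esum_(s in setT) (a s)%:E < +oo)%E <-> exists M, forall n, bsum a n <= M).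
Proof.
move=> a0; split=> [fin|[M hM]].
  have f0 : (0 <= \esum_(s in setT) (a s)%:E)%E.
    by apply: esum_ge0 => s _; rewrite lee_fin.
  exists (fine (\esum_(s in setT) (a s)%:E)) => n.
  rewrite -lee_fin fineK ?ge0_fin_numE //.
  apply: esum_ge; exists [set` box n]; first by split; [exact: finite_seq|].

  by rewrite -fsbig_seq ?box_uniq // sumEFin.
apply: (@le_lt_trans _ _ M%:E); last exact: ltry.
apply: ge_ereal_sup => _ [X [/finite_seqP[r ->] _] <-].
have -> : [set` r] = [set` undup r] by apply/seteqP; split=> x /=; rewrite mem_undup.
rewrite -fsbig_seq ?undup_uniq // sumEFin lee_fin.
pose n := (\max_(s <- undup r) maxn s.1.+1 s.2.+1)%N.
apply: le_trans (hM n); apply: le_uniq_sum; rewrite ?undup_uniq ?box_uniq //.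
move=> s sr; rewrite mem_box -geq_max.
exact: (@leq_bigmax_seq _ _ xpredT (fun s : nat * nat => maxn s.1.+1 s.2.+1)).
Qed.

Lemma bsum_cvg a M : (forall s, 0 <= a s) -> (forall n, bsum a n <= M) -> cvgn (bsum a).
Proof.
move=> a0 h; apply: nondecreasing_is_cvgn; first exact: bsum_nd.
by exists M => _ [n _ <-].
Qed.

Lemma bsum_cvg_abs a b M : (forall s, `|a s| <= b s) -> (forall n, bsum b n <= M) ->
  cvgn (bsum a).
Proof.
move=> ab h.
have b0 s : 0 <= b s by apply: le_trans (ab s).
have cb := bsum_cvg b0 h.
have abb : forall n, bsum (fun s => a s + b s) n <= M + M.
  move=> n; rewrite /bsum big_split /=; apply: lerD; last exact: h.
  by apply: le_trans (h n); apply: ler_sum => s _; apply: le_trans (ab s); apply: ler_norm.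
have cab : cvgn (bsum (fun s => a s + b s)).
  apply: (bsum_cvg _ abb) => s; have := ab s; rewrite ler_norml => /andP[]; lra.
have -> : bsum a = bsum (fun s => a s + b s) \- bsum b.
  by apply/funext => n /=; rewrite /bsum big_split /= addrK.
exact: is_cvgB.
Qed.

End SquareSums.

Section Ell2.
Variables (R : realType) (H : hilbertType R).

Definition square_summable : {pred N2 -> H} :=
  fun f => `[< (\esum_(s in setT) (rnorm (f s) ^+ 2)%:E < +oo)%E >].

Lemma square_summableP (f : N2 -> H) : f \in square_summable <->
  exists M, forall n, bsum (fun s => rnorm (f s) ^+ 2) n <= M.
Proof.
rewrite -esum_bsum => [|s]; last exact: sqr_ge0.
by split => /asboolP.
Qed.

Lemma square_summable_submod : submod_closed square_summable.
Proof.
split.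
  apply/square_summableP; exists 0 => n; rewrite /bsum big1 // => s _.
  by rewrite /rnorm normr0 expr0n.
move=> c f g /square_summableP[M hM] /square_summableP[N hN].
apply/square_summableP; exists (2 * (Normc.normc c ^+ 2 * M) + 2 * N) => n.
apply: (@le_trans _ _ (\sum_(s <- box n)
   (2 * (Normc.normc c ^+ 2 * rnorm (f s) ^+ 2) + 2 * rnorm (g s) ^+ 2))).
  apply: ler_sum => s _; apply: le_trans (rnormD_sqr _ _) _.
  by rewrite rnormZ exprMn.
rewrite big_split /= -!mulr_sumr; apply: lerD; rewrite ler_pM2l //; last exact: hN.
by rewrite ler_wpM2l ?sqr_ge0 //; exact: hM.
Qed.

HB.instance Definition _ :=
  GRing.isSubmodClosed.Build R[i] (N2 -> H) square_summable
    square_summable_submod.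

(* l^2(N^2, H) *)
Record ell2 := Ell2 {
  ell2_fun :> N2 -> H;
  ell2P : ell2_fun \in square_summable
}.

HB.instance Definition _ := [isSub for ell2_fun].
HB.instance Definition _ := [Choice of ell2 by <:].
HB.instance Definition _ := [SubChoice_isSubLmodule of ell2 by <:].

Implicit Types f g h : ell2.

(* the inner product sum_s <f(s), g(s)>: the family is absolutely summable, so its
   sum is the limit of the sums over the squares [0, n) x [0, n) *)
Definition ell2_partial f g n : R[i] :=
  \sum_(0 <= i < n) \sum_(0 <= j < n) dot (f (i, j)) (g (i, j)).

Definition ell2_dot f g : R[i] :=
  (limn (fun n => complex.Re (ell2_partial f g n))
   +i* limn (fun n => complex.Im (ell2_partial f g n)))%C.

Lemma ell2_eqP f g : (forall s, f s = g s) -> f = g.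
Proof. by move=> fg; apply: val_inj; apply/funext. Qed.

Lemma ell2_partialE f g n :
  ell2_partial f g n = \sum_(s <- box n) dot (f s) (g s).
Proof. by rewrite big_allpairs. Qed.

Lemma ell2_Re_partial f g : (fun n => complex.Re (ell2_partial f g n)) =
  bsum (fun s => complex.Re (dot (f s) (g s))).
Proof.
apply/funext => n; rewrite ell2_partialE /bsum.
by apply: (big_morph (@complex.Re R)) => // -[? ?] [? ?].
Qed.

Lemma ell2_Im_partial f g : (fun n => complex.Im (ell2_partial f g n)) =
  bsum (fun s => complex.Im (dot (f s) (g s))).
Proof.
apply/funext => n; rewrite ell2_partialE /bsum.
by apply: (big_morph (@complex.Im R)) => // -[? ?] [? ?].
Qed.

Lemma normc_Re (z : R[i]) : `|complex.Re z| <= Normc.normc z.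
Proof. by rewrite -lecR; exact: normc_ge_Re. Qed.

Lemma normc_Im (z : R[i]) : `|complex.Im z| <= Normc.normc z.
Proof.
case: z => a b /=; rewrite -sqrtr_sqr ler_sqrt ?addr_ge0 ?sqr_ge0 //.
by rewrite lerDr sqr_ge0.
Qed.

Lemma ell2_sqr_bound f g : exists M, forall n,
  bsum (fun s => rnorm (f s) ^+ 2 + rnorm (g s) ^+ 2) n <= M.
Proof.
have /square_summableP[M hM] := ell2P f; have /square_summableP[N hN] := ell2P g.
by exists (M + N) => n; rewrite /bsum big_split /=; apply: lerD; [exact: hM|exact: hN].
Qed.

Lemma ell2_Re_cvg f g : cvgn (bsum (fun s => complex.Re (dot (f s) (g s)))).
Proof.
have [M hM] := ell2_sqr_bound f g; apply: (bsum_cvg_abs _ hM) => s.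
exact: le_trans (normc_Re _) (dot_le_sqr _ _).
Qed.

Lemma ell2_Im_cvg f g : cvgn (bsum (fun s => complex.Im (dot (f s) (g s)))).
Proof.
have [M hM] := ell2_sqr_bound f g; apply: (bsum_cvg_abs _ hM) => s.
exact: le_trans (normc_Im _) (dot_le_sqr _ _).
Qed.

Lemma ell2_dotE f g : ell2_dot f g =
  (limn (bsum (fun s => complex.Re (dot (f s) (g s))))
   +i* limn (bsum (fun s => complex.Im (dot (f s) (g s)))))%C.
Proof. by rewrite /ell2_dot ell2_Re_partial ell2_Im_partial. Qed.

Lemma ell2_dotDl f g h : ell2_dot (f + g) h = ell2_dot f h + ell2_dot g h.
Proof.
rewrite !ell2_dotE.
have -> : bsum (fun s => complex.Re (dot ((f + g) s) (h s))) =
  bsum (fun s => complex.Re (dot (f s) (h s))) \+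
  bsum (fun s => complex.Re (dot (g s) (h s))).
  apply/funext => n; rewrite /= /bsum -big_split; apply: eq_bigr => s _.
  by rewrite /= dotDl; case: (dot _ _) => ? ?; case: (dot _ _).
have -> : bsum (fun s => complex.Im (dot ((f + g) s) (h s))) =
  bsum (fun s => complex.Im (dot (f s) (h s))) \+
  bsum (fun s => complex.Im (dot (g s) (h s))).
  apply/funext => n; rewrite /= /bsum -big_split; apply: eq_bigr => s _.
  by rewrite /= dotDl; case: (dot _ _) => ? ?; case: (dot _ _).
rewrite (limD (@ell2_Re_cvg f h) (@ell2_Re_cvg g h)).
by rewrite (limD (@ell2_Im_cvg f h) (@ell2_Im_cvg g h)).
Qed.

Lemma ell2_dotZl (c : R[i]) f g : ell2_dot (c *: f) g = c * ell2_dot f g.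
Proof.
rewrite !ell2_dotE; case: c => a b.
set u := bsum (fun s => complex.Re (dot (f s) (g s))).
set v := bsum (fun s => complex.Im (dot (f s) (g s))).
have cu : cvgn u := @ell2_Re_cvg f g; have cv : cvgn v := @ell2_Im_cvg f g.
have -> : bsum (fun s => complex.Re (dot (((a +i* b)%C *: f) s) (g s))) =
    (fun n => a * u n - b * v n).
  apply/funext => n; rewrite /u /v /bsum !mulr_sumr -sumrB; apply: eq_bigr => s _.
  by rewrite /= dotZl; case: (dot _ _).
have -> : bsum (fun s => complex.Im (dot (((a +i* b)%C *: f) s) (g s))) =
    (fun n => a * v n + b * u n).
  apply/funext => n; rewrite /u /v /bsum !mulr_sumr -big_split; apply: eq_bigr => s _.
  by rewrite /= dotZl; case: (dot _ _).
have -> : limn (fun n => a * u n - b * v n) = a * limn u - b * limn v.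
  by apply/cvg_lim => //; apply: cvgB; [exact: cvgMl_tmp cu|exact: cvgMl_tmp cv].
have -> // : limn (fun n => a * v n + b * u n) = a * limn v + b * limn u.
by apply/cvg_lim => //; apply: cvgD; [exact: cvgMl_tmp cv|exact: cvgMl_tmp cu].
Qed.

Lemma ell2_dotC f g : ell2_dot g f = (ell2_dot f g)^*.
Proof.
rewrite !ell2_dotE.
have -> : bsum (fun s => complex.Re (dot (g s) (f s))) =
  bsum (fun s => complex.Re (dot (f s) (g s))).
  by apply/funext => n; apply: eq_bigr => s _; rewrite dotC; case: (dot _ _).
have -> : bsum (fun s => complex.Im (dot (g s) (f s))) =
  (fun n => - bsum (fun s => complex.Im (dot (f s) (g s))) n).
  apply/funext => n; rewrite -sumrN; apply: eq_bigr => s _.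
  by rewrite dotC; case: (dot _ _).
by congr (_ +i* _)%C; apply: (limN (@ell2_Im_cvg f g)).
Qed.

Definition ell2_nsq f : R := limn (bsum (fun s => rnorm (f s) ^+ 2)).

Lemma ell2_dot_nsq f : ell2_dot f f = (ell2_nsq f)%:C%C.
Proof.
rewrite ell2_dotE; congr (_ +i* _)%C.
  by congr (limn _); apply/funext => n; apply: eq_bigr => s _; rewrite dot_rnorm.
rewrite (_ : bsum _ = fun _ => 0) ?lim_cst //.
by apply/funext => n; rewrite /bsum big1 // => s _; rewrite dot_rnorm.
Qed.

Lemma ell2_nsq_cvg f : cvgn (bsum (fun s => rnorm (f s) ^+ 2)).
Proof.
have /square_summableP[M hM] := ell2P f.
by apply: (bsum_cvg _ hM) => s; exact: sqr_ge0.
Qed.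

Lemma ell2_nsq_ge f n : bsum (fun s => rnorm (f s) ^+ 2) n <= ell2_nsq f.
Proof.
by apply: nondecreasing_cvgn_le (@ell2_nsq_cvg f) n; apply: bsum_nd => s; exact: sqr_ge0.
Qed.

Lemma ell2_nsq_le f (M : R) :
  (forall n, bsum (fun s => rnorm (f s) ^+ 2) n <= M) -> ell2_nsq f <= M.
Proof. by move=> h; apply: limr_le; [exact: ell2_nsq_cvg|exact: nearW]. Qed.

Lemma ell2_nsq_coord f s : rnorm (f s) ^+ 2 <= ell2_nsq f.
Proof.
apply: le_trans (ell2_nsq_ge f (maxn s.1 s.2).+1).
have -> : rnorm (f s) ^+ 2 = \sum_(t <- [:: s]) rnorm (f t) ^+ 2 by rewrite big_seq1.
apply: le_uniq_sum; rewrite ?box_uniq // => t; first exact: sqr_ge0.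
by rewrite inE mem_box => /eqP->; rewrite !ltnS leq_maxl leq_maxr.
Qed.

Lemma ell2_nsq_ge0 f : 0 <= ell2_nsq f.
Proof. exact: le_trans (sqr_ge0 _) (ell2_nsq_coord f (0, 0)). Qed.

Lemma ell2_dot_ge0 f : 0 <= ell2_dot f f.
Proof. by rewrite ell2_dot_nsq ler0c ell2_nsq_ge0. Qed.

Lemma ell2_dot_eq0 f : ell2_dot f f = 0 -> f = 0.
Proof.
rewrite ell2_dot_nsq => /complexI f0; apply: ell2_eqP => s.
have := ell2_nsq_coord f s; rewrite f0 => h.
have : rnorm (f s) ^+ 2 = 0 by apply/eqP; rewrite eq_le h sqr_ge0.
by move=> h0; apply: dot_eq0; rewrite dot_rnorm h0.
Qed.

Definition ell2_norm f : R[i] := sqrtC (ell2_dot f f).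

Lemma ell2_normD f g : ell2_norm (f + g) <= ell2_norm f + ell2_norm g.
Proof.
exact: (ip_triangle ell2_dotDl ell2_dotZl ell2_dotC ell2_dot_ge0 ell2_dot_eq0).
Qed.

Lemma ell2_normZ (c : R[i]) f : ell2_norm (c *: f) = `|c| * ell2_norm f.
Proof. exact: (ip_scale ell2_dotZl ell2_dotC). Qed.

Lemma ell2_norm_eq0 f : ell2_norm f = 0 -> f = 0.
Proof. by move=> /eqP; rewrite sqrtC_eq0 => /eqP /ell2_dot_eq0. Qed.

HB.instance Definition _ := Lmodule_isNormed.Build R[i] ell2
  ell2_normD ell2_normZ ell2_norm_eq0.

Lemma ell2_dot_norm f : ell2_dot f f = `|f| ^+ 2.
Proof. by rewrite [`|f|]/(ell2_norm f) sqrtCK. Qed.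

Lemma ell2_norm_le f (e : R) : 0 <= e -> (`|f| <= e%:C%C) = (ell2_nsq f <= e ^+ 2).
Proof.
move=> e0; rewrite -lecR rmorphXn /= -ell2_dot_nsq ell2_dot_norm.
by rewrite ler_pXn2r // nnegrE ?ler0c.
Qed.

Lemma posC (e : R[i]) : 0 < e -> exists2 r : R, 0 < r & e = r%:C%C.
Proof.
by case: e => a b; rewrite ltcE /= => /andP[/eqP-> a0]; exists a.
Qed.

Lemma rnorm_cvg (T : Type) (F : set_system T) (FF : Filter F) (u : T -> H) (l : H) :
  u x @[x --> F] --> l -> rnorm (u x) @[x --> F] --> rnorm l.
Proof.
move=> ul; apply/cvgrPdist_lt => e e0.
have e0' : 0 < e%:C%C :> R[i] by rewrite ltcR.
have /cvgrPdist_lt/(_ _ e0') := ul; apply: filterS => x.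
rewrite -rnormE ltcR; apply: le_lt_trans.
have h1 := rnormD (l - u x) (u x); have h2 := rnormD (u x - l) l.
move: h1 h2; rewrite !subrK -(rnormN (u x - l)) opprB => h1 h2.
rewrite ler_norml; lra.
Qed.

Lemma ell2_complete (F : set_system ell2) : ProperFilter F -> cauchy F -> cvg F.
Proof.
move=> FF /cauchy_ballP Fc.
have coord (f h : ell2) s (e : R) : 0 < e -> ball f e%:C%C h -> ball (f s) e%:C%C (h s).
  move=> e0; rewrite -!ball_normE /= -(rnormE (f s - h s)) ltcR => fh.
  have nn : ell2_nsq (f - h) < e ^+ 2.
    rewrite -ltcR rmorphXn /= -ell2_dot_nsq ell2_dot_norm.
    by rewrite ltr_pXn2r // nnegrE ?ler0c // ltW.
  rewrite -(@ltr_pXn2r _ 2) ?nnegrE ?rnorm_ge0 ?(ltW e0) //.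
  by apply: le_lt_trans nn; exact: (ell2_nsq_coord (f - h) s).
have cs s : cvg ((fun f : ell2 => f s) @ F).
  apply: cauchy_cvg; apply/cauchy_ballP => _ /posC[e e0 ->].
  have e0' : 0 < e%:C%C :> R[i] by rewrite ltcR.
  have [[A B] [/= FA FB] h] := Fc _ e0'.
  exists ((fun f : ell2 => f s) @` A, (fun f : ell2 => f s) @` B).
    by split => /=; [apply: filterS FA|apply: filterS FB] => f ?; exists f.
  by move=> [x y] /= [[f Af <-] [k Bk <-]]; apply: coord => //; exact: (h (f, k)).
pose g s := lim ((fun f : ell2 => f s) @ F).
have key (e : R) : 0 < e -> exists2 A, F A &
    forall f : ell2, A f -> forall n, bsum (fun s => rnorm (f s - g s) ^+ 2) n <= e ^+ 2.
  move=> e0; have e0' : 0 < e%:C%C :> R[i] by rewrite ltcR.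
  have [[A B] [/= FA FB] h] := Fc _ e0'; exists A => // f Af n.
  have cv : bsum (fun s => rnorm (f s - (k : ell2) s) ^+ 2) n @[k --> F] -->
      bsum (fun s => rnorm (f s - g s) ^+ 2) n.
    apply: cvg_big => [|s _]; first exact: add_continuous.
    apply: cvgM; apply: rnorm_cvg;
    by apply: cvgB; [exact: cvg_cst|exact: cs].
  rewrite -(cvg_lim _ cv) //; apply: limr_le; first by apply/cvg_ex; eexists; exact: cv.
  apply: filterS FB => k Bk; have := h (f, k) (conj Af Bk).
  rewrite -ball_normE /= => fk.
  apply: le_trans (ell2_nsq_ge (f - k) n) _.
  by rewrite -ell2_norm_le; [exact: ltW|exact: ltW].
have [A1 FA1 hA1] := key 1 ltr01.
have [f Af] := filter_ex FA1.
have dP : (fun s => f s - g s) \in square_summable.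
  by apply/square_summableP; exists (1 ^+ 2) => n; exact: hA1.
pose G : ell2 := f - Ell2 dP.
have GE s : G s = g s by rewrite /= opprB addrC subrK.
apply/cvg_ex; exists G; apply/cvgrPdist_le => _ /posC[e e0 ->].
have [A FA hA] := key _ e0; apply: filterS FA => k Ak.
rewrite distrC ell2_norm_le; last exact: ltW.
apply: ell2_nsq_le => n.
apply: le_trans (hA k Ak n); apply: ler_sum => s _.
by rewrite -GE.
Qed.

HB.instance Definition _ := Uniform_isComplete.Build ell2 ell2_complete.

HB.instance Definition _ := isHilbert.Build R ell2
  ell2_dotDl ell2_dotZl ell2_dotC ell2_dot_norm.

End Ell2.

HB.mixin Record isCStarAlgebra (R : realType) A of CompleteNormedModule R[i] A := {
  cmul : A -> A -> A;
  cstar : A -> A;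
  cmulA : forall a b c, cmul a (cmul b c) = cmul (cmul a b) c;
  cmulDl : forall a b c, cmul (a + b) c = cmul a c + cmul b c;
  cmulDr : forall a b c, cmul a (b + c) = cmul a b + cmul a c;
  cmulZl : forall (l : R[i]) a b, cmul (l *: a) b = l *: cmul a b;
  cmulZr : forall (l : R[i]) a b, cmul a (l *: b) = l *: cmul a b;
  cstarK : forall a, cstar (cstar a) = a;
  cstarD : forall a b, cstar (a + b) = cstar a + cstar b;
  cstarZ : forall (l : R[i]) a, cstar (l *: a) = l^* *: cstar a;
  cstarM : forall a b, cstar (cmul a b) = cmul (cstar b) (cstar a);
  cmul_norm : forall a b, `|cmul a b| <= `|a| * `|b|;
  cstar_norm2 : forall a, `|cmul (cstar a) a| = `|a| ^+ 2
}.

(* C*-algebras, not necessarily unital *)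
#[short(type="cstarType")]
HB.structure Definition CStarAlgebra (R : realType) :=
  {A of CompleteNormedModule R[i] A & isCStarAlgebra R A}.

Notation "a ** b" := (cmul a b) (at level 40, left associativity) : ring_scope.

Section CStarTheory.
Variables (R : realType) (A : cstarType R).
Implicit Types a b c : A.

Lemma cmul0l a : 0 ** a = 0.
Proof. by rewrite -(scale0r (0 : A)) cmulZl !scale0r. Qed.

Lemma cmul0r a : a ** 0 = 0.
Proof. by rewrite -(scale0r (0 : A)) cmulZr !scale0r. Qed.

Lemma cmulNl a b : (- a) ** b = - (a ** b).
Proof. by rewrite -scaleN1r cmulZl scaleN1r. Qed.

Lemma cmulNr a b : a ** (- b) = - (a ** b).
Proof. by rewrite -scaleN1r cmulZr scaleN1r. Qed.

Lemma cstarN a : cstar (- a) = - cstar a.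
Proof. by rewrite -scaleN1r cstarZ rmorphN1 scaleN1r. Qed.

Lemma norm_cstar a : `|cstar a| = `|a|.
Proof.
have le b : `|b| <= `|cstar b|.
  have [->|b0] := eqVneq b 0; first by rewrite normr0.
  by rewrite -(@ler_pM2r _ `|b|) ?normr_gt0 // -expr2 -cstar_norm2 cmul_norm.
by apply/eqP; rewrite eq_le le andbT -{2}(cstarK a) le.
Qed.

End CStarTheory.

(* M(B) as the set of double centralizers (L, R) of B: pairs of maps with
   a L(b) = R(a) b.  The multiplier m acts by m b = L(b) and b m = R(b).
   Linearity and boundedness of L and R, L(ab) = L(a)b and R(ab) = aR(b)
   follow from this identity. *)
Record multiplier (R : realType) (B : cstarType R) := Multiplier {
  mlact : B -> B;
  mract : B -> B;
  multiplierP : forall a b, a ** mlact b = mract a ** b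
}.

Section Multipliers.
Variables (R : realType) (B : cstarType R).
Implicit Types (a b c : B) (m n : multiplier B).

Lemma mof_subproof b a c : a ** (b ** c) = (a ** b) ** c.
Proof. exact: cmulA. Qed.

(* the inclusion of B in M(B) *)
Definition mof b : multiplier B := Multiplier (mof_subproof b).

Lemma mone_subproof a b : a ** id b = id a ** b.
Proof. by []. Qed.

Definition mone : multiplier B := Multiplier mone_subproof.

Lemma madd_subproof m n a b :
  a ** (mlact m b + mlact n b) = (mract m a + mract n a) ** b.
Proof. by rewrite cmulDl cmulDr !multiplierP. Qed.

Definition madd m n : multiplier B := Multiplier (madd_subproof m n).

Lemma mscale_subproof (l : R[i]) m a b :
  a ** (l *: mlact m b) = (l *: mract m a) ** b.
Proof. by rewrite cmulZl cmulZr !multiplierP. Qed.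

Definition mscale (l : R[i]) m : multiplier B := Multiplier (mscale_subproof l m).

Definition msub m n : multiplier B := madd m (mscale (-1) n).

Lemma mmul_subproof m n a b :
  a ** (mlact m \o mlact n) b = (mract n \o mract m) a ** b.
Proof. by rewrite /= !multiplierP. Qed.

Definition mmul m n : multiplier B := Multiplier (mmul_subproof m n).

Lemma mstar_subproof m a b :
  a ** cstar (mract m (cstar b)) = cstar (mlact m (cstar a)) ** b.
Proof. by rewrite -{1}(cstarK a) -cstarM -multiplierP cstarM cstarK. Qed.

(* m^* b = (b^* m)^* and b m^* = (m b^* )^* *)
Definition mstar m : multiplier B := Multiplier (mstar_subproof m).

End Multipliers.
Arguments mone {R} B.

Section Operators.
Variables (R : realType) (K : hilbertType R).
Implicit Types S T : K -> K.

Definition bounded_operator T := linear T /\ continuous T.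

Definition adjoint_of T S := forall x y, dot (T x) y = dot x (S y).

(* T^*; for a bounded operator T it exists by the Riesz representation theorem,
   and it is unique *)
Definition adj T : K -> K := xget (fun _ => 0) [set S | adjoint_of T S].

Definition partial_isometry T := T \o adj T \o T = T.

End Operators.

Definition lspan (R : realType) (V : lmodType R[i]) (S : set V) : set V :=
  [set x | exists n (c : 'I_n -> R[i]) (v : 'I_n -> V),
     (forall i, S (v i)) /\ x = \sum_(i < n) c i *: v i].

Definition cspan (R : realType) (V : normedModType R[i]) (S : set V) : set V :=
  closure (lspan S).

Definition star_hom (R : realType) (A B : cstarType R) (f : A -> B) :=
  [/\ linear f, forall a b, f (a ** b) = f a ** f b
    & forall a, f (cstar a) = cstar (f a)].

Definition representation (R : realType) (A : cstarType R) (K : hilbertType R)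
    (rho : A -> K -> K) :=
  [/\ forall a, bounded_operator (rho a), linear rho,
      forall a b, rho (a ** b) = rho a \o rho b
    & forall a, adjoint_of (rho a) (rho (cstar a))].

Definition nondegenerate_hom (R : realType) (A B : cstarType R) (f : A -> B) :=
  cspan [set z | exists a b, z = f a ** b] = setT.

Definition nondegenerate_rep (R : realType) (A : cstarType R) (K : hilbertType R)
    (rho : A -> K -> K) :=
  cspan [set z | exists a x, z = rho a x] = setT.

Definition irreducible (R : realType) (A : cstarType R) (K : hilbertType R)
    (rho : A -> K -> K) :=
  forall M : set K, M 0 -> (forall c x y, M x -> M y -> M (c *: x + y)) -> closed M ->
    (forall a x, M x -> M (rho a x)) -> M = [set 0] \/ M = setT.

(* Phi extends phi along the inclusion of B in M(B); for nondegenerate phi such a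
   Phi is unique *)
Definition extends_to_multipliers (R : realType) (B : cstarType R)
    (K : hilbertType R) (phi : B -> K -> K) (Phi : multiplier B -> K -> K) :=
  [/\ forall m, bounded_operator (Phi m),
      forall l m n, Phi (madd (mscale l m) n) = l *: Phi m + Phi n,
      forall m n, Phi (mmul m n) = Phi m \o Phi n,
      forall m, adjoint_of (Phi m) (Phi (mstar m))
    & forall b, Phi (mof b) = phi b].

Definition joinN2 (s t : N2) : N2 := (maxn s.1 t.1, maxn s.2 t.2).

Definition automorphic_action (R : realType) (A : cstarType R) (alpha : N2 -> A -> A) :=
  [/\ forall s, star_hom (alpha s) /\ bijective (alpha s),
      alpha 0 = id
    & forall s t, alpha (s + t) = alpha s \o alpha t].

Section Covariance.
Variables (R : realType) (A : cstarType R) (alpha : N2 -> A -> A).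

Definition covariant_piso (K : hilbertType R) (rho : A -> K -> K) (W : N2 -> K -> K) :=
  [/\ representation rho /\ nondegenerate_rep rho,
      forall s, bounded_operator (W s) /\ partial_isometry (W s),
      [/\ W 0 = id, forall s t, W s \o W t = W (s + t)
        & forall s t, adj (W s) \o W s \o adj (W t) \o W t =
                      adj (W (joinN2 s t)) \o W (joinN2 s t)],
      forall s a, rho (alpha s a) = W s \o rho a \o adj (W s)
    & forall s a, adj (W s) \o W s \o rho a = rho a \o adj (W s) \o W s].

Variables (B : cstarType R) (iA : A -> B) (iN : N2 -> multiplier B).

Definition is_integrated_form (K : hilbertType R) (rho : A -> K -> K)
    (W : N2 -> K -> K) (phi : B -> K -> K) :=
  [/\ representation phi, nondegenerate_rep phi, phi \o iA = rho
    & exists2 Phi, extends_to_multipliers phi Phi & Phi \o iN = W].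

(* rho x W, unique by the universal property when (rho, W) is covariant *)
Definition integrated_form (K : hilbertType R) (rho : A -> K -> K)
    (W : N2 -> K -> K) : B -> K -> K :=
  xget (fun _ _ => 0) [set phi | is_integrated_form rho W phi].

Definition piso_crossed_product :=
  [/\ star_hom iA /\ nondegenerate_hom iA,
      [/\ forall s, mmul (mmul (iN s) (mstar (iN s))) (iN s) = iN s,
          iN 0 = mone B,
          forall s t, mmul (iN s) (iN t) = iN (s + t)
        & forall s t, mmul (mmul (mstar (iN s)) (iN s)) (mmul (mstar (iN t)) (iN t)) =
            mmul (mstar (iN (joinN2 s t))) (iN (joinN2 s t))],
      (forall s a, iA (alpha s a) = mract (mstar (iN s)) (mlact (iN s) (iA a))) /\
      (forall s a, mlact (mmul (mstar (iN s)) (iN s)) (iA a) =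
                   mract (mmul (mstar (iN s)) (iN s)) (iA a)),
      cspan [set z | exists s t a,
        z = mract (iN t) (mlact (mstar (iN s)) (iA a))] = setT
    & forall (K : hilbertType R) (rho : A -> K -> K) (W : N2 -> K -> K),
        covariant_piso rho W -> exists! phi, is_integrated_form rho W phi].

(* i(s)^* iA(a) [1 - i(1,0)^* i(1,0)] i(t) *)
Definition xi (s t : N2) (a : A) : B :=
  mract (iN t)
    (mract (msub (mone B) (mmul (mstar (iN (1, 0)%N)) (iN (1, 0)%N)))
       (mlact (mstar (iN s)) (iA a))).

Definition idealL : set B :=
  cspan [set z | exists a s t,
    z = xi s t a - xi (s + (0, 1)%N) (t + (0, 1)%N) (alpha (0, 1)%N a)].

End Covariance.

Lemma ell2_shift_summable (R : realType) (H : hilbertType R) (t : N2) (f : ell2 H) :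
  (fun s => f (s + t)) \in @square_summable R H.
Proof.
have /square_summableP[M hM] := ell2P f.
apply/square_summableP; exists M => n; apply: le_trans (hM (n + t.1 + t.2)%N).
rewrite /bsum -(@big_map _ _ _ _ _ (fun s => s + t) (box n) xpredT
  (fun s => rnorm (f s) ^+ 2)).
apply: le_uniq_sum; rewrite ?box_uniq //.
- by move=> s; exact: sqr_ge0.
- rewrite map_inj_uniq ?box_uniq // => -[i j] [k l] [e1 e2].
  by congr (_, _); move: e1 e2; rewrite !natrDE; lia.
- move=> _ /mapP[s + ->]; rewrite !mem_box /= => /andP[h1 h2].
  by rewrite !natrDE; apply/andP; split; lia.
Qed.

Definition ell2_shift (R : realType) (H : hilbertType R) (t : N2) (f : ell2 H) : ell2 H :=
  Ell2 (ell2_shift_summable t f).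

(* (pi~(a) f)(s) = pi(alpha_s(a)) f(s), see pi_tildeE *)
Definition pi_tilde (R : realType) (A : cstarType R) (alpha : N2 -> A -> A)
    (H : hilbertType R) (pi : A -> H -> H) (a : A) (f : ell2 H) : ell2 H :=
  insubd (0 : ell2 H) (fun s => pi (alpha s a) (f s)).

Section Contractivity.
Variables (R : realType) (A : cstarType R).
Implicit Types a h k : A.

Lemma norm_le_eps (x : A) (C : R[i]) : 0 < C ->
  (forall e : R[i], 0 < e -> `|x| <= C * e) -> x = 0.
Proof.
move=> C0 hx; apply/eqP; rewrite -normr_eq0; apply/negP => /negP x0.
have xp : 0 < `|x| by rewrite lt_def x0 normr_ge0.
have e0 : 0 < `|x| / (2 * C) by rewrite divr_gt0 // mulr_gt0 // ltr0n.
have := hx _ e0.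
have -> : C * (`|x| / (2 * C)) = `|x| / 2 by field; rewrite gt_eqF.
rewrite ler_pdivlMr ?ltr0n // mulr_natr mulr2n gerDl => h.
by have := lt_le_trans xp h; rewrite ltxx.
Qed.

Lemma cmulB_sqr (x y : A) : x ** x - y ** y = (x - y) ** x + y ** (x - y).
Proof. by rewrite cmulDl cmulDr cmulNl cmulNr addrA subrK. Qed.

Section SquareRoot.
Variable h : A.
Hypotheses (h_sa : cstar h = h) (h_lt1 : `|h| < 1).
Let r := `|h|.

Fixpoint sqrt_seq n : A :=
  if n is m.+1 then 2^-1 *: (h ** h + sqrt_seq m ** sqrt_seq m) else 0.

Let r0 : 0 <= r. Proof. exact: normr_ge0. Qed.

Let half (x : R[i]) : 2^-1 * (x + x) = x.
Proof. by field. Qed.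

Let half0 : `|2^-1 : R[i]| = 2^-1.
Proof. by rewrite ger0_norm // invr_ge0 ler0n. Qed.

Let half_gt0 : 0 < 2^-1 :> R[i].
Proof. by rewrite invr_gt0 ltr0n. Qed.

Lemma sqrt_seq_norm n : `|sqrt_seq n| <= r.
Proof.
elim: n => [|n ih] /=; first by rewrite normr0.
rewrite normrZ half0 -[leRHS]half ler_pM2l //.
apply: le_trans (ler_normD _ _) _; apply: lerD.
  by apply: le_trans (cmul_norm _ _) _; rewrite -[leRHS]mulr1 ler_wpM2l // ltW.
apply: le_trans (cmul_norm _ _) _; rewrite -[leRHS]mulr1.
by apply: ler_pM => //; apply: le_trans ih _; exact: ltW.
Qed.

Lemma sqrt_seq_sa n : cstar (sqrt_seq n) = sqrt_seq n.
Proof.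
elim: n => [|n ih] /=.
  by rewrite -(scale0r (0 : A)) cstarZ rmorph0 !scale0r.
by rewrite cstarZ cstarD !cstarM h_sa ih fmorphV rmorph_nat.
Qed.

Lemma sqrt_seq_step n : `|sqrt_seq n.+1 - sqrt_seq n| <= r ^+ n.
Proof.
elim: n => [|n ih].
  rewrite expr0 subr0; apply: le_trans (sqrt_seq_norm 1) _; exact: ltW.
have -> : sqrt_seq n.+2 - sqrt_seq n.+1 =
    2^-1 *: (sqrt_seq n.+1 ** sqrt_seq n.+1 - sqrt_seq n ** sqrt_seq n).
  by rewrite [sqrt_seq n.+2]/= [in X in _ - X = _]/= -scalerBr opprD addrACA subrr add0r.
rewrite cmulB_sqr normrZ half0 -[leRHS]half ler_pM2l // exprS.
apply: le_trans (ler_normD _ _) _; apply: lerD; apply: le_trans (cmul_norm _ _) _.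
  by rewrite mulrC; apply: ler_pM => //; exact: sqrt_seq_norm.
by apply: ler_pM => //; exact: sqrt_seq_norm.
Qed.

Lemma sqrt_seq_cauchy n p :
  `|sqrt_seq (n + p) - sqrt_seq n| * (1 - r) <= r ^+ n - r ^+ (n + p).
Proof.
elim: p => [|p ih]; first by rewrite addn0 !subrr normr0 mul0r.
rewrite addnS.
have -> : sqrt_seq (n + p).+1 - sqrt_seq n =
  (sqrt_seq (n + p).+1 - sqrt_seq (n + p)) + (sqrt_seq (n + p) - sqrt_seq n).
  by rewrite addrA subrK.
have r1 : 0 <= 1 - r by rewrite subr_ge0 ltW.
apply: le_trans (ler_wpM2r r1 (ler_normD _ _)) _; rewrite mulrDl.
have -> : r ^+ n - r ^+ (n + p).+1 =
   r ^+ (n + p) * (1 - r) + (r ^+ n - r ^+ (n + p)) by rewrite exprS; ring.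
by apply: lerD => //; apply: ler_wpM2r => //; exact: sqrt_seq_step.
Qed.

Lemma sqrt_seq_cvg : cvgn sqrt_seq.
Proof.
apply: cauchy_cvg; apply/cauchy_ballP => _ /posC[e e0 ->].
pose q : R := complex.Re r.
have qE : r = q%:C%C by rewrite RRe_real // normr_real.
have q0 : 0 <= q by rewrite -ler0c -qE.
have q1 : 0 < 1 - q by rewrite subr_gt0 -ltcR -qE.
have : (fun n => q ^+ n) @ \oo --> (0 : R).
  by apply: cvg_expr; rewrite ger0_norm // -subr_gt0.
have d0 : 0 < e * (1 - q) / 2 by rewrite divr_gt0 // mulr_gt0.
move=> /cvgrPdist_lt/(_ _ d0) [N _ hN].
have est n : (N <= n)%N -> `|sqrt_seq n - sqrt_seq N| < (e / 2)%:C%C.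
  move=> Nn; have := hN N (leqnn N); rewrite /= sub0r normrN ger0_norm ?exprn_ge0 // => hq.
  have := sqrt_seq_cauchy N (n - N); rewrite subnKC // => hc.
  have q1C : 0 < 1 - r by rewrite subr_gt0.
  rewrite -(ltr_pM2r q1C); apply: le_lt_trans hc _.
  apply: (@le_lt_trans _ _ (r ^+ N)); first by rewrite gerBl exprn_ge0.
  have -> : (e / 2)%:C%C * (1 - r) = (e * (1 - q) / 2)%:C%C.
    by rewrite qE -(rmorph1 (real_complex R)) -rmorphB -rmorphM /=; congr (_%:C%C); ring.
  by rewrite qE -rmorphXn ltcR.
exists (sqrt_seq @` [set n | (N <= n)%N], sqrt_seq @` [set n | (N <= n)%N]).
  by split; exists N => // n Nn; exists n.
move=> [x y] /= [[n Nn <-] [m Nm <-]]; rewrite -ball_normE /=.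
have -> : sqrt_seq n - sqrt_seq m =
  (sqrt_seq n - sqrt_seq N) + (sqrt_seq N - sqrt_seq m) by rewrite addrA subrK.
apply: le_lt_trans (ler_normD _ _) _.
have -> : e%:C%C = (e / 2)%:C%C + (e / 2)%:C%C :> R[i].
  by rewrite -rmorphD /=; congr (_%:C%C); field.
by apply: ltrD; [exact: est|rewrite distrC; exact: est].
Qed.

Lemma sqrt_exists : exists2 k : A, cstar k = k & h ** h = 2 *: k - k ** k.
Proof.
pose k := limn sqrt_seq.
have near0 (e : R[i]) : 0 < e -> exists n,
    `|k - sqrt_seq n| <= e /\ `|k - sqrt_seq n.+1| <= e.
  move=> e0; have /cvgrPdist_le/(_ _ e0) [N _ hN] : sqrt_seq @ \oo --> k.
    exact: sqrt_seq_cvg.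
  by exists N; split; [exact: (hN N (leqnn N))|exact: (hN N.+1 (leqnSn N))].
exists k.
  apply/eqP; rewrite -subr_eq0; apply/eqP.
  apply: (@norm_le_eps _ 2); first by rewrite ltr0n.
  move=> e /near0[n [hn _]].
  have -> : cstar k - k = cstar (k - sqrt_seq n) + (sqrt_seq n - k).
    by rewrite cstarD cstarN sqrt_seq_sa addrA subrK.
  apply: le_trans (ler_normD _ _) _; rewrite norm_cstar (distrC (sqrt_seq n)).
  by rewrite mulr_natl mulr2n lerD.
suff kE : k - 2^-1 *: (h ** h + k ** k) = 0.
  move/eqP: kE; rewrite subr_eq0 => /eqP {1}->.
  by rewrite scalerA divff ?pnatr_eq0 // scale1r addrK.
apply: (@norm_le_eps _ (1 + (r + `|k|))).
  by rewrite ltr_pwDl // addr_ge0.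
move=> e e0; have [n [hn hn1]] := near0 _ e0.
have -> : k - 2^-1 *: (h ** h + k ** k) = (k - sqrt_seq n.+1) -
    2^-1 *: (k ** k - sqrt_seq n ** sqrt_seq n).
  rewrite /= -addrA -opprD -scalerDr; congr (_ - _ *: _).
  by rewrite addrACA addrN addr0.
apply: le_trans (ler_normB _ _) _; rewrite mulrDl mul1r; apply: lerD => //.
rewrite cmulB_sqr normrZ half0.
apply: (@le_trans _ _ (`|(k - sqrt_seq n) ** k + sqrt_seq n ** (k - sqrt_seq n)|)).
  by rewrite ler_piMl // invf_le1 ?ltr0n // ler1n.
apply: le_trans (ler_normD _ _) _; rewrite mulrDl addrC.
apply: lerD; apply: le_trans (cmul_norm _ _) _.
  by apply: ler_pM => //; exact: sqrt_seq_norm.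
by rewrite mulrC; apply: ler_pM.
Qed.

End SquareRoot.

Variables (H : hilbertType R) (rho : A -> H -> H).
Hypothesis rho_rep : representation rho.

Lemma rep_le1_sa h x : cstar h = h -> `|h| < 1 -> `|rho h x| <= `|x|.
Proof.
case: rho_rep => _ rl rM rs hs h1.
have [k ks hk] := sqrt_exists hs h1.
have sa (u : A) y z : cstar u = u -> dot (rho u y) z = dot y (rho u z).
  by move=> us; rewrite rs us.
rewrite -(@ler_pXn2r _ 2) ?nnegrE // -!dot_norm sa // -[rho h (rho h x)]/((rho h \o rho h) x).
rewrite -rM hk -subr_ge0.
have -> : rho (2 *: k - k ** k) x = 2 *: rho k x - rho k (rho k x).
  have -> : 2 *: k - k ** k = (- 1) *: (k ** k) + 2 *: k by rewrite scaleN1r addrC.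
  rewrite rl; have := rl 2 k 0; rewrite addr0 => ->.
  have r0 : rho 0 = 0 by have := rl (-1) 0 0; rewrite scaler0 addr0 scaleN1r addNr.
  by rewrite r0 addr0 rM scaleN1r /= addrC.
have -> : dot x x - dot x (2 *: rho k x - rho k (rho k x)) =
    dot (x - rho k x) (x - rho k x).
  rewrite -(scaleN1r (rho k (rho k x))) -(scaleN1r (rho k x)) !(dotDr, dotZr, dotDl, dotZl) !(sa k) // rmorphN1 rmorph_nat.
  by ring.
exact: dot_ge0.
Qed.

Lemma rep_le1 a x : `|a| < 1 -> `|rho a x| <= `|x|.
Proof.
move=> a1; case: rho_rep => _ _ rM rs.
rewrite -(@ler_pXn2r _ 2) ?nnegrE // -dot_norm rs.
rewrite -[rho _ (rho a x)]/((rho (cstar a) \o rho a) x) -rM.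
apply: le_trans (real_ler_norm _) _.
  by rewrite realE rM /= -rs dot_ge0.
apply: le_trans (dot_norm_le _ _) _; rewrite expr2; apply: ler_wpM2l => //.
apply: rep_le1_sa; first by rewrite cstarM cstarK.
by rewrite cstar_norm2 exprn_ilt1.
Qed.

Lemma rep_bound a x : `|rho a x| <= (`|a| + 1) * `|x|.
Proof.
have c0 : 0 < `|a| + 1 by rewrite ltr_pwDr.
have [_ rl _ _] := rho_rep.
have r0 : rho 0 = 0 by have := rl (-1) 0 0; rewrite scaler0 addr0 scaleN1r addNr.
have aE : a = (`|a| + 1) *: ((`|a| + 1)^-1 *: a).
  by rewrite scalerA divff ?scale1r // gt_eqF.
rewrite {1}aE -[X in rho X]addr0 rl r0 addr0 normrZ ger0_norm; last exact: ltW.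
rewrite ler_pM2l //; apply: rep_le1.
rewrite normrZ normfV ger0_norm; last exact: ltW.
by rewrite mulrC ltr_pdivrMr // mul1r ltrDl.
Qed.

End Contractivity.

Lemma pi_tildeE (R : realType) (A : cstarType R) (alpha : N2 -> A -> A)
    (H : hilbertType R) (pi : A -> H -> H) (a : A) (f : ell2 H) (s : N2) :
  automorphic_action alpha -> representation pi ->
  pi_tilde alpha pi a f s = pi (alpha s a) (f s).
Proof.
move=> [hal _ _] hpi; rewrite /pi_tilde insubdK //.
have bnd t : `|pi (alpha t a) (f t)| <= (`|a| + 1) * `|f t|.
  apply: (@rep_bound _ _ _ (fun b => pi (alpha t b))).
  have [[al aM as_] _] := hal t; have [pb pl pM ps] := hpi; split.
  - by move=> b; exact: pb.
  - by move=> c b b'; rewrite al pl.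
  - by move=> b b'; rewrite aM pM.
  - by move=> b; rewrite as_; exact: ps.
have /square_summableP[M hM] := ell2P f.
pose c : R := complex.Re `|a| + 1.
apply/square_summableP; exists (c ^+ 2 * M) => n.
apply: le_trans (_ : _ <= c ^+ 2 * bsum (fun t => rnorm (f t) ^+ 2) n) _.
  rewrite /bsum mulr_sumr; apply: ler_sum => t _.
  have ca : c%:C%C = `|a| + 1 by rewrite rmorphD rmorph1 /= RRe_real ?normr_real.
  have c0 : 0 <= c by rewrite -ler0c ca addr_ge0.
  rewrite -exprMn ler_pXn2r ?nnegrE ?rnorm_ge0 ?mulr_ge0 ?rnorm_ge0 //.
  by rewrite -lecR rmorphM /= !rnormE ca.
by apply: ler_wpM2l (hM n); exact: sqr_ge0.
Qed.

(* Main.v *)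
Require Import Defs.
From HB Require Import structures.
From mathcomp Require Import all_boot all_order all_algebra.
From mathcomp Require Import complex ring lra zify.
From mathcomp Require Import all_classical all_reals.
From mathcomp Require Import ereal topology normedtype sequences esum.
Set Implicit Arguments. Unset Strict Implicit. Unset Printing Implicit Defensive.
Import Order.TTheory GRing.Theory Num.Theory.
Import numFieldNormedType.Exports.
Local Open Scope classical_set_scope.
Local Open Scope ring_scope.

(** The representation is irreducible because the ideal acts on l^2(N^2, H) by matrix
    units with entries in [pi A].

    The shifts V_t are coisometries: the adjoint of V_t pushes a function up by [t] and
    fills with zeros ([shift_adjoint]), so V_t^* V_t is the restriction of functions to
    the points above [t] ([coshift_shift]). All the covariance relations are then
    pointwise identities ([pi_tilde_shift_covariant]), and the universal property provides
    the integrated form phi.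

    By [integrated_xi], phi sends the element xi of [s], [t] and [a] to the operator
    V_s^* pi~(a) (1 - V_(1,0)^* V_(1,0)) V_t. Forming the difference that generates the
    ideal replaces the middle projection by the projection onto the functions supported
    at the origin, so the generator z attached to [s], [t] and [a] acts by
      phi(z) f = delta_s (pi(a) f(t)),
    where delta_s x is the function with value x at s and 0 elsewhere
    ([matrix_unit_formula]).

    From a nonzero f in an invariant closed subspace M these operators produce vectors
    delta_s (pi(a) f(t)) in M, not all zero; as [pi] is irreducible, M contains delta_s x
    for all s and x ([irreducible_of_matrix_units]), and these vectors are total
    ([ell2_total]). The same formula at s = t = 0 gives a generator of the ideal that does
    not act by zero, because [pi] is not zero. *)

(** * Closed subspaces of normed spaces *)

Section ClosedSubspaces.
Variable R : realType.

Lemma linear_at0 (U V : lmodType R[i]) (T : U -> V) : linear T -> T 0 = 0.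
Proof. by move=> lT; have := lT (-1) 0 0; rewrite scaler0 addr0 scaleN1r addNr. Qed.

Definition closed_subspace (V : normedModType R[i]) (M : set V) :=
  [/\ M 0, forall c x y, M x -> M y -> M (c *: x + y) & closed M].

Variables (V W : normedModType R[i]).
Implicit Types (M S : set V) (x y z : V).

Lemma closure_norm_ltP S x :
  closure S x <-> forall e : R[i], 0 < e -> exists2 y, S y & `|x - y| < e.
Proof.
split=> [Sx e e0|h U].
  have /Sx[y [Sy xy]] : nbhs x (ball x e) by exact: nbhsx_ballx.
  by exists y => //; move: xy; rewrite -ball_normE.
move=> /nbhs_ballP[e /= e0 eU]; have [y Sy xy] := h e e0.
by exists y; split=> //; apply: eU; rewrite -ball_normE.
Qed.

Lemma closed_approx M x : closed M ->
  (forall e : R[i], 0 < e -> exists2 y, M y & `|x - y| < e) -> M x.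
Proof. by move=> cM h; apply: cM; apply/closure_norm_ltP. Qed.

Lemma closed_subspace_preimage (T : V -> W) (M : set W) :
  linear T -> continuous T -> closed_subspace M -> closed_subspace (T @^-1` M).
Proof.
move=> lT cT [M0 MD cM]; split.
- by rewrite /= linear_at0.
- by move=> c x y /= Mx My; rewrite lT; exact: MD.
- by move/continuous_closedP: cT; exact.
Qed.

Lemma sub_cspan S : S `<=` cspan S.
Proof.
move=> x Sx; apply: subset_closure; exists 1, (fun=> 1), (fun=> x).
by rewrite big_ord1 scale1r.
Qed.

Lemma cspan_closed_subspace S : closed_subspace (cspan S).
Proof.
have lspanD c x y : lspan S x -> lspan S y -> lspan S (c *: x + y).
  move=> [n [a [v [Sv ->]]]] [m [b [w [Sw ->]]]].
  exists (n + m)%N, (fun i => match fintype.split i with inl j => c * a j | inr j => b j end),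
    (fun i => match fintype.split i with inl j => v j | inr j => w j end).
  split; first by move=> i; case: fintype.split.
  rewrite big_split_ord /= scaler_sumr; congr (_ + _); apply: eq_bigr => i _.
    by rewrite (unsplitK (inl i)) scalerA.
  by rewrite (unsplitK (inr i)).
split; last exact: closed_closure.
  apply: subset_closure; exists 0, (fun=> 0), (fun=> 0).
  by rewrite big_ord0; split => // -[].
move=> c x y /closure_norm_ltP Sx /closure_norm_ltP Sy; apply/closure_norm_ltP => e e0.
have c0 : 0 < `|c| + 1 by rewrite ltr_pwDr.
have [x' Sx' xx'] := Sx (e / 2 / (`|c| + 1)) (divr_gt0 (divr_gt0 e0 (ltr0Sn _ 1)) c0).
have [y' Sy' yy'] := Sy (e / 2) (divr_gt0 e0 (ltr0Sn _ 1)).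
exists (c *: x' + y'); first exact: lspanD.
rewrite opprD addrACA -scalerBr [ltRHS](splitr e).
apply: le_lt_trans (ler_normD _ _) _; rewrite normrZ; apply: ler_ltD => //.
apply: (@le_trans _ _ ((`|c| + 1) * `|x - x'|)).
  by rewrite ler_wpM2r // lerDl.
by rewrite mulrC -ler_pdivlMr // ltW.
Qed.

(** Turns the density hypotheses on generators into containments: nondegeneracy says
    that a closed span is everything, so a closed subspace containing the generators
    is everything too. *)
Lemma cspan_min S M : closed_subspace M -> S `<=` M -> cspan S `<=` M.
Proof.
move=> [M0 MD cM] SM x /closure_norm_ltP h; apply: closed_approx => // e /h[y [n [c [v [Sv ->]]]] xy].
exists (\sum_(i < n) c i *: v i) => //.
apply: (big_ind M) => // [u w Mu Mw|i _].
  by rewrite -[u]scale1r; exact: MD.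
by rewrite -[_ *: _]addr0; apply: MD => //; exact: SM.
Qed.

Lemma linear_norm_le_continuous (T : V -> W) (C : R[i]) : 0 <= C ->
  linear T -> (forall x, `|T x| <= C * `|x|) -> continuous T.
Proof.
move=> C0 lT hT x; apply/cvgrPdist_lt => e e0.
have c0 : 0 < C + 1 by rewrite ltr_pwDr.
have : \forall y \near x, `|x - y| < e / (C + 1).
  by apply/nbhs_normP; exists (e / (C + 1)) => //=; exact: divr_gt0.
apply: filterS => y xy.
have -> : T x - T y = T (x - y).
  by rewrite addrC -scaleN1r -lT scaleN1r addrC.
apply: le_lt_trans (hT _) _.
apply: (@le_lt_trans _ _ ((C + 1) * `|x - y|)).
  by rewrite ler_wpM2r // lerDl.
by rewrite mulrC -ltr_pdivlMr.
Qed.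

(** The bound stands in for the continuity of [F]; for the functionals given by inner
    products it is the Cauchy-Schwarz inequality. *)
Lemma closed_subspace_ker (F : V -> R[i]) (C : R[i]) : 0 <= C ->
  (forall c x y, F (c *: x + y) = c * F x + F y) ->
  (forall x, `|F x| <= C * `|x|) -> closed_subspace [set x | F x = 0].
Proof.
move=> C0 lF hF; split=> /=.
- by have := lF (-1) 0 0; rewrite scaler0 addr0 mulN1r addNr.
- by move=> c x y Fx Fy; rewrite lF Fx Fy mulr0 addr0.
move=> x /closure_norm_ltP h /=; apply/eqP; rewrite -normr_eq0; apply/negP => /negP n0.
have np : 0 < `|F x| by rewrite lt_def n0 /=.
have c0 : 0 < C + 1 by rewrite ltr_pwDr.
have [y /= Fy xy] := h (`|F x| / (C + 1)) (divr_gt0 np c0).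
have : `|F x| < `|F x|; last by rewrite ltxx.
have {1}-> : F x = F (x - y) by rewrite addrC -scaleN1r lF Fy mulr0 add0r.
apply: le_lt_trans (hF _) _.
by apply: (@le_lt_trans _ _ ((C + 1) * `|x - y|)); [rewrite ler_wpM2r // lerDl|rewrite mulrC -ltr_pdivlMr].
Qed.

End ClosedSubspaces.

(** * Adjoints in a Hilbert space *)

Section Adjoint.
Variables (R : realType) (K : hilbertType R).
Implicit Types (T S : K -> K) (x y z : K).

Lemma dot0l x : dot 0 x = 0.
Proof. by rewrite -(scale0r (0 : K)) dotZl mul0r. Qed.

Lemma dot0r x : dot x 0 = 0.
Proof. by rewrite dotC dot0l rmorph0. Qed.

Lemma dot_sep x y : (forall z, dot z x = dot z y) -> x = y.
Proof.
move=> h; apply/eqP; rewrite -subr_eq0; apply/eqP/dot_eq0.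
by rewrite {2}addrC -(scaleN1r y) dotDr dotZr h rmorphN1 mulN1r addNr.
Qed.

(** Adjoints are unique, so the choice made in [adj] returns any explicit adjoint. *)
Lemma adjE T S : adjoint_of T S -> adj T = S.
Proof.
move=> TS; rewrite /adj; case: xgetP => [_ -> /= TS'|/(_ S)/(_ TS)//].
by apply/funext => y; apply: dot_sep => z; rewrite -TS -TS'.
Qed.

(** Reduces the identity [dot (T x) y = dot x z] between bounded maps to a total
    set of vectors [x]. *)
Lemma closed_subspace_dotl y z (T : K -> K) (C : R[i]) : 0 <= C -> linear T ->
  (forall x, `|T x| <= C * `|x|) ->
  closed_subspace [set x | dot (T x) y = dot x z].
Proof.
move=> C0 lT hT.
suff -> : [set x | dot (T x) y = dot x z] =
    [set x | dot (T x) y - dot x z = 0].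
  apply: (@closed_subspace_ker _ _ _ (C * `|y| + `|z|)).
  - by rewrite addr_ge0 ?mulr_ge0.
  - by move=> c u v; rewrite lT !dotDl !dotZl; ring.
  - move=> x; apply: le_trans (ler_normB _ _) _; rewrite mulrDl; apply: lerD.
      apply: le_trans (dot_norm_le _ _) _.
      by rewrite mulrAC ler_wpM2r.
    by apply: le_trans (dot_norm_le _ _) _; rewrite mulrC.
by apply/seteqP; split=> x /= /eqP; rewrite ?subr_eq0 => /eqP // ->; rewrite subrr.
Qed.

End Adjoint.

(** * Elementary vectors of l^2(N^2, H) *)

Section Delta.
Variables (R : realType) (H : hilbertType R).
Implicit Types (f g : ell2 H) (x y : H) (s t : N2).

Lemma ell2D f g s : (f + g) s = f s + g s.
Proof. by []. Qed.

Lemma ell2Z c f s : (c *: f) s = c *: f s.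
Proof. by []. Qed.

Lemma ell2N f s : (- f) s = - f s.
Proof. by []. Qed.

Lemma bsum_supp1 (a : N2 -> R) s n : (forall t, t != s -> a t = 0) ->
  bsum a n = if s \in box n then a s else 0.
Proof.
move=> a0; rewrite /bsum; case: ifPn => sn.
  rewrite (bigD1_seq s) ?box_uniq //= big1 ?addr0 // => t; exact: a0.
rewrite big_seq big1 // => t tn; apply: a0.
by apply: contraNneq sn => <-.
Qed.

Lemma lim_bsum_supp1 (a : N2 -> R) s : (forall t, t != s -> a t = 0) ->
  limn (bsum a) = a s.
Proof.
move=> a0; apply/cvg_lim => //; apply: cvg_near_cst.
exists (maxn s.1 s.2).+1 => // n /= sn.
by rewrite (bsum_supp1 _ a0) mem_box !(leq_trans _ sn) // ltnS ?leq_maxl ?leq_maxr.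
Qed.

Lemma delta_summable s x : (fun t => if t == s then x else 0) \in @square_summable R H.
Proof.
apply/square_summableP; exists (rnorm x ^+ 2) => n.
rewrite (@bsum_supp1 _ s) ?eqxx => [|t /negbTE->]; first by case: ifP; rewrite ?sqr_ge0.
by rewrite /rnorm normr0 expr0n.
Qed.

Definition delta s x : ell2 H := Ell2 (delta_summable s x).

Lemma deltaE s x t : delta s x t = if t == s then x else 0.
Proof. by []. Qed.

Lemma delta_linear s : linear (delta s).
Proof.
move=> c x y; apply: ell2_eqP => t.
by rewrite ell2D ell2Z !deltaE; case: eqP => // _; rewrite scaler0 addr0.
Qed.

Lemma dot_delta s x g : dot (delta s x) g = dot x (g s).
Proof.
have -> : dot (delta s x) g = ell2_dot (delta s x) g by [].
rewrite ell2_dotE.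
rewrite !(@lim_bsum_supp1 _ s) /= ?eqxx => [|t /negbTE->|t /negbTE->]; rewrite ?dot0l //.
by case: (dot _ _).
Qed.

Lemma norm_delta s x : `|delta s x| = `|x|.
Proof.
apply/eqP; rewrite -(@eqrXn2 _ 2) // -!dot_norm dot_delta /= eqxx.
by [].
Qed.

Lemma delta_continuous s : continuous (delta s).
Proof.
apply: (linear_norm_le_continuous ler01 (@delta_linear s)) => x.
by rewrite norm_delta mul1r.
Qed.

Lemma ell2_sumE (I : Type) (r : seq I) (F : I -> ell2 H) s :
  (\sum_(i <- r) F i) s = \sum_(i <- r) F i s.
Proof. by elim/big_rec2: _ => // i x y _ <-. Qed.

Lemma truncE f n s :
  (\sum_(t <- box n) delta t (f t)) s = if s \in box n then f s else 0.
Proof.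
rewrite ell2_sumE; case: ifPn => sn.
  rewrite (bigD1_seq s) ?box_uniq //= eqxx big1 ?addr0 // => t.
  by rewrite eq_sym => /negbTE->.
rewrite big_seq big1 // => t tn /=; case: eqP => // st.
by move: sn; rewrite st tn.
Qed.

(** The squared norm of the tail is the squared norm of [f] minus that of its
    truncation, which tends to 0; each box is enlarged to contain the other so that
    both sums run over the same finite set. *)
Lemma ell2_tail f n m :
  bsum (fun s => rnorm ((f - \sum_(t <- box n) delta t (f t)) s) ^+ 2) m <=
  ell2_nsq f - bsum (fun s => rnorm (f s) ^+ 2) n.
Proof.
set a := fun s => rnorm (f s) ^+ 2.
set b := fun s => _.
have bE s : b s = if s \in box n then 0 else a s.
  rewrite /b ell2D ell2N truncE; case: ifP; rewrite ?subr0 ?subrr //.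
  by rewrite /rnorm normr0 expr0n.
have b0 s : 0 <= b s by exact: sqr_ge0.
apply: le_trans (bsum_nd b0 (leq_maxl m n)) _.
rewrite lerBrDr; apply: le_trans (ell2_nsq_ge f (maxn m n)).
rewrite -/a /bsum [leRHS](bigID (fun s => s \in box n)) /= [leLHS]addrC.
rewrite (eq_bigr _ (fun s _ => bE s)) lerD //.
  rewrite -[leRHS]big_filter; apply: le_uniq_sum; rewrite ?filter_uniq ?box_uniq //.
    by move=> s; exact: sqr_ge0.
  move=> s; rewrite mem_filter => sn; rewrite sn /=; move: sn; rewrite !mem_box => /andP[h1 h2].
  by rewrite !(leq_trans _ (leq_maxr m n)).
rewrite big_mkcond [leRHS]big_mkcond; apply: ler_sum => s _.
by case: ifP.
Qed.

(** Every [f] is the limit of its truncations to boxes, which are finite sums of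
    elementary vectors. *)
Lemma ell2_total (M : set (ell2 H)) :
  closed_subspace M -> (forall s x, M (delta s x)) -> M = setT.
Proof.
move=> [M0 MD cM] Md; apply/seteqP; split=> // f _.
apply: closed_approx => // _ /posC[e e0 ->].
have e20 : 0 < (e / 2) ^+ 2 by rewrite exprn_gt0 // divr_gt0.
have /cvgrPdist_le/(_ _ e20)[n _ hn] := @ell2_nsq_cvg _ _ f.
exists (\sum_(t <- box n) delta t (f t)).
  apply: (big_ind M) => // u w Mu Mw.
  by rewrite -[u]scale1r; exact: MD.
apply: (@le_lt_trans _ _ (e / 2)%:C%C); last by rewrite ltcR; lra.
rewrite ell2_norm_le; last lra.
apply: ell2_nsq_le => m; apply: le_trans (ell2_tail _ _ _) _.
apply: le_trans (ler_norm _) _; exact: (hn n (leqnn n)).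
Qed.

End Delta.

(** * Backward shifts and their adjoints *)

Section Shift.
Variables (R : realType) (H : hilbertType R).
Implicit Types (f g : ell2 H) (x y : H) (r s t : N2).

Lemma ell2_norm_le_scale f g (c : R) : 0 <= c ->
  (forall n, bsum (fun s => rnorm (g s) ^+ 2) n <= c ^+ 2 * ell2_nsq f) ->
  `|g| <= c%:C%C * `|f|.
Proof.
move=> c0 h.
have cf0 : 0 <= c%:C%C * `|f| by rewrite mulr_ge0 // ler0c.
rewrite -(@ler_pXn2r _ 2) ?nnegrE // exprMn -!ell2_dot_norm !ell2_dot_nsq.
by rewrite -rmorphXn -rmorphM /= lecR; exact: ell2_nsq_le.
Qed.

Definition leN2 t s := (t.1 <= s.1)%N && (t.2 <= s.2)%N.
Definition subN2 s t : N2 := (s.1 - t.1, s.2 - t.2)%N.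

Lemma subN2K s t : leN2 t s -> subN2 s t + t = s.
Proof.
case: s t => [a b] [c d] /andP[/= ac bd].
by congr (_, _); rewrite natrDE subnK.
Qed.

Lemma addN2K s t : subN2 (s + t) t = s.
Proof. by case: s t => [a b] [c d]; congr (_, _); rewrite /= natrDE addnK. Qed.

Lemma leN2_addr s t : leN2 t (s + t).
Proof. by rewrite /leN2 /= !natrDE !leq_addl. Qed.

Lemma eq_addN2 r s t : (r + t == s) = leN2 t s && (r == subN2 s t).
Proof.
apply/eqP/andP => [<-|[ts /eqP->]]; last exact: subN2K.
by rewrite leN2_addr addN2K.
Qed.

Lemma leN2_join s t r : leN2 (joinN2 s t) r = leN2 s r && leN2 t r.
Proof. by rewrite /leN2 /joinN2 /= !geq_max andbACA. Qed.

Lemma shiftE t f s : ell2_shift t f s = f (s + t).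
Proof. by []. Qed.

Lemma shift_linear t : linear (@ell2_shift R H t).
Proof. by move=> c f g; exact: ell2_eqP. Qed.

Lemma norm_shift t f : `|ell2_shift t f| <= 1 * `|f|.
Proof.
apply: (@ell2_norm_le_scale _ _ 1) => // n; rewrite expr1n mul1r.
apply: le_trans (ell2_nsq_ge f (n + t.1 + t.2)%N).
rewrite /bsum -(@big_map _ _ _ _ _ (fun s => s + t) (box n) xpredT
  (fun s => rnorm (f s) ^+ 2)).
apply: le_uniq_sum; rewrite ?box_uniq //.
- by move=> s; exact: sqr_ge0.
- by rewrite map_inj_uniq ?box_uniq //; apply: (can_inj (g := subN2^~ t)) => s; exact: addN2K.
- move=> _ /mapP[s + ->]; rewrite !mem_box /= => /andP[h1 h2].
  by rewrite !natrDE; apply/andP; split; lia.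
Qed.

Lemma shift_continuous t : continuous (@ell2_shift R H t).
Proof.
exact: (linear_norm_le_continuous ler01 (@shift_linear t) (@norm_shift t)).
Qed.

Lemma coshift_summable t f :
  (fun s => if leN2 t s then f (subN2 s t) else 0) \in @square_summable R H.
Proof.
apply/square_summableP; exists (ell2_nsq f) => n.
apply: le_trans (ell2_nsq_ge f n).
have -> : bsum (fun s => rnorm (if leN2 t s then f (subN2 s t) else 0) ^+ 2) n =
    \sum_(r <- [seq subN2 s t | s <- box n & leN2 t s]) rnorm (f r) ^+ 2.
  rewrite big_map big_filter [RHS]big_mkcond; apply: eq_bigr => s _.
  by case: ifP => // _; rewrite /rnorm normr0 expr0n.
apply: le_uniq_sum; rewrite ?box_uniq //.
- by move=> s; exact: sqr_ge0.
- rewrite map_inj_in_uniq ?filter_uniq ?box_uniq // => r s.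
  rewrite !mem_filter => /andP[tr _] /andP[ts _] e.
  by rewrite -(subN2K tr) -(subN2K ts) e.
- move=> _ /mapP[s + ->]; rewrite mem_filter !mem_box /= => /and3P[_ h1 h2].
  by rewrite !(leq_ltn_trans (leq_subr _ _)).
Qed.

Definition coshift t f : ell2 H := Ell2 (coshift_summable t f).

Lemma coshiftE t f s : coshift t f s = if leN2 t s then f (subN2 s t) else 0.
Proof. by []. Qed.

(** Both sides are bounded in [f], so it is enough to compare them on elementary
    vectors, which the shift moves or kills. *)
Lemma shift_adjoint t : adjoint_of (@ell2_shift R H t) (coshift t).
Proof.
move=> f g; rewrite -[_ = _]/([set f | dot (ell2_shift t f) g = dot f (coshift t g)] f).
rewrite (@ell2_total _ _ [set f | _]) //.
  exact: (closed_subspace_dotl _ _ ler01 (@shift_linear t) (@norm_shift t)).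
move=> s x /=; rewrite dot_delta coshiftE; case: ifPn => ts.
  rewrite -dot_delta; congr dot; apply: ell2_eqP => r.
  by rewrite shiftE !deltaE eq_addN2 ts.
have -> : ell2_shift t (delta s x) = 0.
  by apply: ell2_eqP => r; rewrite shiftE deltaE eq_addN2 (negbTE ts).
by rewrite dot0l dot0r.
Qed.

Lemma adj_shift t : adj (@ell2_shift R H t) = coshift t.
Proof. exact/adjE/shift_adjoint. Qed.

Lemma shiftK t : cancel (coshift t) (@ell2_shift R H t).
Proof.
by move=> f; apply: ell2_eqP => s; rewrite shiftE coshiftE leN2_addr addN2K.
Qed.

(** The initial projection of the shift by [t] is the restriction to the points
    above [t]; this explains the join relation, since lying above both [s] and [t] is
    lying above their join. *)
Lemma coshift_shift t f s :
  coshift t (ell2_shift t f) s = if leN2 t s then f s else 0.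
Proof. by rewrite coshiftE shiftE; case: ifP => // /subN2K->. Qed.

Lemma ell2_shift0 : @ell2_shift R H 0 = id.
Proof. by apply/funext => f; apply: ell2_eqP => s; rewrite shiftE addr0. Qed.

Lemma shiftD s t : @ell2_shift R H s \o ell2_shift t = ell2_shift (s + t).
Proof.
apply/funext => f; apply: ell2_eqP => r.
by rewrite [LHS]/= shiftE addrA.
Qed.

Lemma coshift_shift_join s t :
  coshift s \o @ell2_shift R H s \o coshift t \o ell2_shift t =
  coshift (joinN2 s t) \o ell2_shift (joinN2 s t).
Proof.
apply/funext => f; apply: ell2_eqP => r.
change (coshift s (ell2_shift s (coshift t (ell2_shift t f))) r =
        coshift (joinN2 s t) (ell2_shift (joinN2 s t) f) r).
by rewrite !coshift_shift leN2_join; case: ifP.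
Qed.

End Shift.

(** * Covariance of the pair of pi_tilde and the shifts *)

Section Representations.
Variables (R : realType) (A : cstarType R) (H : hilbertType R) (pi : A -> H -> H).
Hypothesis pi_rep : representation pi.

Lemma rep_at0 a : pi a 0 = 0.
Proof. by have [/(_ a)[/linear_at0]] := pi_rep. Qed.

(** A vector killed by all [pi a] is orthogonal to all [pi a y], because the
    adjoint of [pi a] is [pi (cstar a)]. *)
Lemma nondegenerate_separating : nondegenerate_rep pi ->
  forall x, (forall a, pi a x = 0) -> x = 0.
Proof.
move=> nd x hx; apply: dot_eq0.
have cs : closed_subspace [set y : H | dot y x = 0].
  apply: (closed_subspace_ker (normr_ge0 x)) => [c y z|y].
    by rewrite dotDl dotZl.
  by rewrite mulrC; exact: dot_norm_le.
suff sub : cspan [set z | exists a y, z = pi a y] `<=` [set y : H | dot y x = 0].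
  by apply: sub; rewrite [cspan _]nd.
apply: cspan_min => // _ [a [y ->]] /=.
have [_ _ _ ->] := pi_rep.
by rewrite hx dot0r.
Qed.

(** The closed span of the vectors [pi a x] is invariant, and it is not zero. *)
Lemma irreducible_nondegenerate : irreducible pi -> (exists a x, pi a x != 0) ->
  nondegenerate_rep pi.
Proof.
move=> irr [a [x ax]].
have cs := cspan_closed_subspace [set z | exists a x, z = pi a x].
have [M0 MD cM] := cs.
have [//|M0'|//] := irr _ M0 MD cM.
  move=> b y; have [/(_ b)[lb cb] _ _ _] := pi_rep.
  apply: (cspan_min (closed_subspace_preimage lb cb cs)) => _ [c [z ->]] /=.
  by apply: sub_cspan; exists b, (pi c z).
have : cspan [set z | exists a x, z = pi a x] (pi a x).
  by apply: sub_cspan; exists a, x.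
by rewrite M0' /= => h; rewrite h eqxx in ax.
Qed.

Variable alpha : N2 -> A -> A.
Hypothesis alpha_act : automorphic_action alpha.

Local Notation pit := (pi_tilde alpha pi).

Let pitE a f s : pit a f s = pi (alpha s a) (f s).
Proof. exact: pi_tildeE. Qed.

Lemma norm_pi_tilde a f : `|pit a f| <= (`|a| + 1) * `|f|.
Proof.
pose c : R := complex.Re `|a| + 1.
have ca : c%:C%C = `|a| + 1 by rewrite rmorphD rmorph1 /= RRe_real ?normr_real.
have c0 : 0 <= c by rewrite -ler0c ca addr_ge0.
rewrite -ca; apply: ell2_norm_le_scale => // n.
apply: le_trans (ler_wpM2l (sqr_ge0 c) (ell2_nsq_ge f n)).
rewrite /bsum mulr_sumr; apply: ler_sum => t _.
rewrite -exprMn ler_pXn2r ?nnegrE ?rnorm_ge0 ?mulr_ge0 ?rnorm_ge0 //.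
rewrite -lecR rmorphM /= !rnormE ca pitE.
apply: (@rep_bound _ _ _ (fun b => pi (alpha t b))).
have [/(_ t)[[al aM as_] _] _ _] := alpha_act.
have [pb pl pM ps] := pi_rep; split.
- by move=> b; exact: pb.
- by move=> k b b'; rewrite al pl.
- by move=> b b'; rewrite aM pM.
- by move=> b; rewrite as_; exact: ps.
Qed.

Lemma pi_tilde_delta a s x : pit a (delta s x) = delta s (pi (alpha s a) x).
Proof.
apply: ell2_eqP => t; rewrite pitE !deltaE; case: eqP => [->//|_].
exact: rep_at0.
Qed.

Lemma pi_tilde_rep : representation pit.
Proof.
have [hal _ _] := alpha_act; have [pb pl pM ps] := pi_rep.
have lin a : linear (pit a).
  move=> c f g; apply: ell2_eqP => s; rewrite pitE !(ell2D, ell2Z) !pitE.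
  by have [l _] := pb (alpha s a); rewrite l.
split.
- move=> a; split; first exact: lin.
  have a0 : 0 <= `|a| + 1 :> R[i] by rewrite addr_ge0.
  exact: (linear_norm_le_continuous a0 (lin a) (norm_pi_tilde a)).
- move=> c a b; apply/funext => f; apply: ell2_eqP => s.
  have [[al _ _] _] := hal s.
  rewrite pitE al pl.
  by rewrite -[(c *: pit a + pit b) f]/(c *: pit a f + pit b f) ell2D ell2Z !pitE.
- move=> a b; apply/funext => f; apply: ell2_eqP => s.
  have [[_ aM _] _] := hal s.
  by rewrite [(_ \o _) f]/= !pitE aM pM.
- move=> a f g.
  rewrite -[_ = _]/([set f | dot (pit a f) g = dot f (pit (cstar a) g)] f).
  have a0 : 0 <= `|a| + 1 :> R[i] by rewrite addr_ge0.
  rewrite (@ell2_total _ _ [set f | _]) //.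
    exact: (closed_subspace_dotl _ _ a0 (lin a) (norm_pi_tilde a)).
  move=> s x /=; rewrite pi_tilde_delta !dot_delta pitE.
  by have [[_ _ ->] _] := hal s; exact: ps.
Qed.

(** On the summand at [s] the vectors [pi (alpha s a) y] are all the vectors
    [pi b y], because [alpha s] is onto; this is where automorphisms are needed. *)
Lemma pi_tilde_nondegenerate : nondegenerate_rep pi -> nondegenerate_rep pit.
Proof.
move=> nd; apply: ell2_total; first exact: cspan_closed_subspace.
set M := cspan _; have cs : closed_subspace M := cspan_closed_subspace _.
move=> s x.
suff sub : cspan [set z | exists a y, z = pi a y] `<=` delta s @^-1` M.
  by apply: sub; rewrite [cspan _]nd.
have cs' := closed_subspace_preimage (@delta_linear _ _ s) (@delta_continuous _ _ s) cs.
apply: (cspan_min cs') => _ [a [y ->]] /=.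
have [/(_ s)[_ [beta _ betaK]] _ _] := alpha_act.
apply: sub_cspan; exists (beta a), (delta s y).
by rewrite pi_tilde_delta betaK.
Qed.

Lemma pi_tilde_shift_covariant : nondegenerate_rep pi ->
  covariant_piso alpha pit (fun t => ell2_shift t).
Proof.
move=> nd; split.
- by split; [exact: pi_tilde_rep|exact: pi_tilde_nondegenerate].
- move=> s; split; first by split; [exact: shift_linear|exact: shift_continuous].
  rewrite /partial_isometry adj_shift; apply/funext => f /=.
  by rewrite shiftK.
- split; [exact: ell2_shift0|exact: shiftD|move=> s t].
  by rewrite !adj_shift coshift_shift_join.
- move=> s a; rewrite adj_shift; apply/funext => f; apply: ell2_eqP => r.
  change (pit (alpha s a) f r = ell2_shift s (pit a (coshift s f)) r).
  rewrite shiftE !pitE coshiftE leN2_addr addN2K.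
  by have [_ _ ->] := alpha_act.
- move=> s a; rewrite adj_shift; apply/funext => f; apply: ell2_eqP => r.
  change (coshift s (ell2_shift s (pit a f)) r = pit a (coshift s (ell2_shift s f)) r).
  rewrite coshift_shift !pitE coshift_shift.
  by case: ifP => // _; rewrite rep_at0.
Qed.

End Representations.

(** * Multipliers as double centralizers *)

Section MultiplierTheory.
Variables (R : realType) (B : cstarType R).
Implicit Types (a b c : B) (m n : multiplier B).

(** By the C*-identity the difference is already detected by its own adjoint. *)
Lemma cmul_sepr a b : (forall c, a ** c = b ** c) -> a = b.
Proof.
move=> h; apply/eqP; rewrite -subr_eq0 -normr_eq0 -norm_cstar.
have : `|cstar (a - b)| ^+ 2 = 0.
  by rewrite -cstar_norm2 cstarK cmulDl cmulNl h subrr normr0.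
by move/eqP; rewrite expf_eq0.
Qed.

Lemma cmul_sepl a b : (forall c, c ** a = c ** b) -> a = b.
Proof.
move=> h; rewrite -[a]cstarK -[b]cstarK; congr cstar; apply: cmul_sepr => c.
by rewrite -[c]cstarK -!cstarM h.
Qed.

Lemma mractM m a b : mract m (a ** b) = a ** mract m b.
Proof.
by apply: cmul_sepr => c; rewrite -multiplierP -!cmulA multiplierP.
Qed.

Lemma mlactM m a b : mlact m (a ** b) = mlact m a ** b.
Proof.
by apply: cmul_sepl => c; rewrite multiplierP !cmulA multiplierP.
Qed.

(** The compatibility of the two maps is an equation between elements of [B], hence
    proof irrelevant. *)
Lemma multiplier_eq m n : mlact m =1 mlact n -> mract m =1 mract n -> m = n.
Proof.
case: m n => [l r P] [l' r' P'] /= /funext ll /funext rr.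
by subst l' r'; congr Multiplier; exact: Prop_irrelevance.
Qed.

(** Together with [mof_mlact], this lets an extension to multipliers be evaluated on
    products of an element of [B] with multipliers. *)
Lemma mof_mract n b : mof (mract n b) = mmul (mof b) n.
Proof. by apply: multiplier_eq => c /=; rewrite ?multiplierP ?mractM. Qed.

Lemma mof_mlact n b : mof (mlact n b) = mmul n (mof b).
Proof. by apply: multiplier_eq => c /=; rewrite ?multiplierP ?mlactM. Qed.

(** Puts a difference in the shape [l m + n] in which the linearity of an extension to
    multipliers is given. *)
Lemma msubE m n : msub m n = madd (mscale (-1) n) m.
Proof. by apply: multiplier_eq => c /=; rewrite addrC. Qed.

End MultiplierTheory.

(** * Integrated forms on the elements xi *)

Section IntegratedForm.
Variables (R : realType) (A B : cstarType R) (iA : A -> B)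
  (iN : N2 -> multiplier B) (K : hilbertType R) (rho : A -> K -> K)
  (W : N2 -> K -> K) (phi : B -> K -> K).
Hypotheses (iN0 : iN 0 = mone B) (phiP : is_integrated_form iA iN rho W phi)
  (W0 : W 0 = id).

(** Each factor of xi is a multiplier whose image under the extension of [phi] is
    determined by [W], since adjoints are unique. *)
Lemma integrated_xi s t a x : phi (xi iA iN s t a) x =
  adj (W s) (rho a (W t x - adj (W (1, 0)%N) (W (1, 0)%N (W t x)))).
Proof.
have [prep _ phiA [Phi [_ Plin PM Padj Pmof] PN]] := phiP.
have PiN u : Phi (iN u) = W u by rewrite -PN.
have Pstar u : Phi (mstar (iN u)) = adj (W u).
  by rewrite -PiN (adjE (Padj (iN u))).
(* unitality is not part of being an extension: it comes from iN 0 = 1 and W 0 = id *)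
have Pone : Phi (mone B) = id by rewrite -iN0 PiN.
have phir n b : phi (mract n b) = phi b \o Phi n.
  by rewrite -!Pmof mof_mract PM.
have phil n b : phi (mlact n b) = Phi n \o phi b.
  by rewrite -!Pmof mof_mlact PM.
rewrite /xi !phir phil Pstar PiN msubE Plin PM Pstar PiN Pone -phiA /=.
by rewrite scaleN1r addrC.
Qed.

End IntegratedForm.

(** * Matrix units and irreducibility *)

Section MatrixUnits.
Variables (R : realType) (H : hilbertType R).
Implicit Types (f g : ell2 H) (x y : H) (s t : N2).

Lemma coshiftB s f g : coshift s f - coshift s g = coshift s (f - g).
Proof.
apply: ell2_eqP => r; rewrite ell2D ell2N !coshiftE.
by case: ifP => // _; rewrite subrr.
Qed.

Lemma coshiftD s t f : coshift s (coshift t f) = coshift (s + t) f.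
Proof.
apply: dot_sep => g; rewrite -!shift_adjoint; congr dot.
by rewrite addrC -shiftD.
Qed.

Lemma coshift_delta0 s x : coshift s (delta 0 x) = delta s x.
Proof.
apply: ell2_eqP => r; rewrite coshiftE !deltaE.
have -> : (r == s) = leN2 s r && (subN2 r s == 0).
  by rewrite [subN2 r s == 0]eq_sym -eq_addN2 add0r eq_sym.
by case: ifP.
Qed.

Variables (A : cstarType R) (alpha : N2 -> A -> A) (pi : A -> H -> H).
Hypotheses (alpha_act : automorphic_action alpha) (pi_rep : representation pi).

Local Notation sh := (@ell2_shift R H).
Local Notation pit := (pi_tilde alpha pi).

(** The left-hand side is the image of a generator of the ideal. The projection
    onto the points of first coordinate 0 comes from the factor
    [1 - i(1,0)^* i(1,0)]; subtracting the same term moved by (0, 1) leaves only the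
    points of second coordinate 0, by the equality of [alpha] at (i, j + 1) with
    [alpha] at (i, j) composed with [alpha] at (0, 1). Only the origin survives. *)
Lemma matrix_unit_formula s t a f :
  coshift s (pit a (sh t f - coshift (1, 0)%N (sh (1, 0)%N (sh t f)))) -
  coshift (s + (0, 1)%N) (pit (alpha (0, 1)%N a)
    (sh (t + (0, 1)%N) f -
       coshift (1, 0)%N (sh (1, 0)%N (sh (t + (0, 1)%N) f)))) =
  delta s (pi a (f t)).
Proof.
have pi0 := rep_at0 pi_rep.
have [_ al0 alD] := alpha_act.
rewrite -coshiftD coshiftB -coshift_delta0; congr coshift.
apply: ell2_eqP => -[i j].
rewrite ell2D ell2N coshiftE !pi_tildeE // !ell2D !ell2N !coshift_shift.
rewrite -[alpha _ (alpha _ a)]/((alpha _ \o alpha _) a) -alD !shiftE deltaE.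
case: i => [|i]; case: j => [|j].
- by rewrite !subr0 add0r (_ : (0%N, 0%N) = 0) // al0.
(* the two terms agree at (0, j + 1), as (0, j) + (0, 1) is that point *)
- by rewrite !subr0 addrA addrAC subN2K // subrr.
- by rewrite subrr pi0 subr0.
- by rewrite !subrr !pi0 subr0.
Qed.

(** If [f] is a nonzero vector of an invariant closed subspace [M], then
    [f t != 0] for some [t]. For each [s] the vectors [x] with [delta s x] in [M] form a
    closed subspace of [H], invariant by the units from [s] to [s] and containing the
    vectors [pi a (f t)] by the units from [t] to [s]. These are not all zero, so
    irreducibility of [pi] gives all of [H], and [M] contains all elementary vectors. *)
Lemma irreducible_of_matrix_units (B : cstarType R) (phi : B -> ell2 H -> ell2 H) :
  irreducible pi -> nondegenerate_rep pi ->
  (forall s t a, exists z, forall f, phi z f = delta s (pi a (f t))) ->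
  irreducible phi.
Proof.
move=> irr nd mu M M0 MD cM inv.
have [[f [Mf f0]]|no] := pselect (exists f, M f /\ f <> 0); last first.
  left; apply/seteqP; split=> [f Mf|_ ->] //=.
  by apply: contrapT => f0; apply: no; exists f.
right; apply: ell2_total => // s.
suff : delta s @^-1` M = setT by move=> e x; rewrite -[M _]/((delta s @^-1` M) x) e.
have csM : closed_subspace M by split.
have [N0 ND cN] :=
  closed_subspace_preimage (@delta_linear _ _ s) (@delta_continuous _ _ s) csM.
have [|N0'|//] := irr _ N0 ND cN.
  move=> a x /= Mx; have [z hz] := mu s s a.
  by have := inv z _ Mx; rewrite hz deltaE eqxx.
case: f0; apply: ell2_eqP => t.
apply: (nondegenerate_separating pi_rep nd) => a.
have [z hz] := mu s t a.
have : (delta s @^-1` M) (pi a (f t)) by rewrite /= -hz; exact: inv.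
by rewrite N0'.
Qed.

End MatrixUnits.

(** * Irreducibility, and the restriction to the ideal *)

Theorem proposition3p1 (R : realType) (A : cstarType R) (alpha : N2 -> A -> A)
    (B : cstarType R) (iA : A -> B) (iN : N2 -> multiplier B)
    (H : hilbertType R) (pi : A -> H -> H) :
  automorphic_action alpha ->
  piso_crossed_product alpha iA iN ->
  representation pi ->
  irreducible pi ->
  (exists a x, pi a x != 0) ->
  let V : N2 -> ell2 H -> ell2 H := fun t => ell2_shift t in
  let phi : B -> ell2 H -> ell2 H := integrated_form iA iN (pi_tilde alpha pi) V in
  [/\ covariant_piso alpha (pi_tilde alpha pi) V,
      irreducible phi
    & exists z f, idealL alpha iA iN z /\ phi z f != 0].
Proof.
move=> alpha_act [_ [_ iN0 _ _] _ _ univ] pi_rep irr pi_neq0 V phi.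
have nd := irreducible_nondegenerate pi_rep irr pi_neq0.
have cov : covariant_piso alpha (pi_tilde alpha pi) V.
  exact: pi_tilde_shift_covariant.
have phiP : is_integrated_form iA iN (pi_tilde alpha pi) V phi.
  by have [psi [psiP _]] := univ _ _ _ cov; exact: (xgetI _ psiP).
pose z s t a := xi iA iN s t a -
  xi iA iN (s + (0, 1)%N) (t + (0, 1)%N) (alpha (0, 1)%N a).
have phi_z s t a f : phi (z s t a) f = delta s (pi a (f t)).
  have [[_ plin _ _] _ _ _] := phiP.
  rewrite /z addrC -scaleN1r plin.
  rewrite -[(_ + phi _) f]/(-1 *: phi _ f + phi _ f).
  rewrite !(integrated_xi iN0 phiP (ell2_shift0 H)).
  by rewrite scaleN1r addrC !adj_shift; exact: matrix_unit_formula.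
split=> //.
  by apply: (irreducible_of_matrix_units pi_rep irr nd) => s t a; exists (z s t a).
have [a [x ax]] := pi_neq0.
exists (z 0 0 a), (delta 0 x); split; first by apply: sub_cspan; exists a, 0, 0.
by rewrite phi_z deltaE eqxx -normr_eq0 norm_delta normr_eq0.
Qed.
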